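(* Let $Z$ be an abelian group, let $\mathcal{A}=\bigoplus_{k\in Z}\mathcal{A}_k$ be a $Z$-graded unital associative algebra over $\mathbb{C}$, and let $M=\bigoplus_{n\in Z}M_n$ be a $Z$-graded-simple quasifinite $\mathcal{A}$-module. Let $\widehat H$ be a finite abelian group of automorphisms of $\mathcal{A}$ preserving the $Z$-grading, such that there exist $Z$-grading-preserving isomorphisms $T_\eta$ between $M$ and $M^\eta$ for all $\eta\in\widehat H$. Let $H=\mathrm{Hom}(\widehat H,\mathbb{C}^* )$ and let $$M=\bigoplus_{h\in H}N\otimes V^h$$ be the isotypic decomposition of $M$ with respect to the action of the cyclotomic quantum torus $\mathcal{R}_q$ given by the operators $T_\eta$ (as set up in the context). In this decomposition, each subspace $V^h$ is $Z$-graded. Then, up to equivalence, thin $H$-coverings of $M$ are parametrized by one-dimensional subspaces of $N$, in the following sense: for $n\in N$, $n\ne0$, define $$M_h=\sum_{\mathbf a\in\mathbb{Z}^r}\mathbf{T}^{\mathbf a}(n)\otimes V^{h+\gamma(\mathbf a)}\qquad(h\in H).$$ Then $\{M_h\mid h\in H\}$ is a thin $H$-covering of $M$, and every thin $H$-covering of $M$ is equivalent to a covering of this type.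
   Context: Modules are left modules. A $Z$-graded module is quasifinite if all its graded components $M_n$ are finite-dimensional (so $M$ may be infinite-dimensional); $Z$-graded-simple means it has no proper nonzero $Z$-graded submodule. An automorphism $\sigma$ of $\mathcal A$ preserves the $Z$-grading if $\sigma(\mathcal{A}_k)=\mathcal{A}_k$ for all $k$. If $\rho$ is the action on $M$, then $M^\sigma$ is the module on the space $M$ with action $\rho\circ\sigma$. $H$ is written additively: $(g+h)(\sigma)=g(\sigma)h(\sigma)$. The algebra is graded by $Z\times H$, with $H$-components $\mathcal{A}_h=\{a\mid\sigma(a)=h(\sigma)a\ \forall\sigma\in\widehat H\}$. An $H$-covering of $M$ is a family $\{M_h\mid h\in H\}$ of $Z$-graded subspaces of $M$ that span $M$ and satisfy $\rho(\mathcal{A}_g)M_h\subseteq M_{g+h}$ for all $g,h\in H$. It is thin if whenever $\{N_h\}$ is an $H$-covering of $M$ with $N_h\subseteq M_h$ for all $h$, then $N_h=M_h$ for all $h$. Coverings $\{M_h\}$, $\{M'_h\}$ are equivalent if for some fixed $k\in H$, $M_h=M'_{h+k}$ for all $h$. Quantum torus action: let $\eta_1,\dots,\eta_r$ generate $\widehat H$ and let $T_j=T_{\eta_j}$ be $Z$-grading-preserving invertible operators on $M$ with $\rho(\eta_j(a))=T_j\rho(a)T_j^{-1}$ for all $a\in\mathcal{A}$. Then $T_iT_j=q_{ij}T_jT_i$ for certain roots of unity $q_{ij}$, and $t_i\mapsto T_i$ makes $M$ a module over the cyclotomic quantum torus $\mathcal{R}_q=\mathcal{R}_q\langle t_1^\pm,\dots,t_r^\pm\rangle$,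 the unital associative algebra generated by invertible $t_1,\dots,t_r$ with relations $t_it_j=q_{ij}t_jt_i$. $N$ is a fixed simple (finite-dimensional) $\mathcal{R}_q$-submodule of $M$. The isotypic decomposition can be written $M\cong\bigoplus_{h\in H}N\otimes V^h$ with vector spaces $V^h$ (possibly zero), the distinct nonzero summands being the distinct isotypic components, with action $t_i(u\otimes v^h)=t_i(u)\otimes h(\eta_i)v^h$ for $u\in N$, $v^h\in V^h$. The $Z$-grading of $V^h$ is the one for which $N\otimes (V^h)_n=(N\otimes V^h)\cap M_n$. Notation: for $\mathbf a\in\mathbb{Z}^r$, $\mathbf T^{\mathbf a}=T_1^{a_1}\cdots T_r^{a_r}$, and $\mathbf T^{\mathbf a}(n)$ for $n\in N$ is the action of $t_1^{a_1}\cdots t_r^{a_r}$ on $N$. The map $\gamma:\mathbb{Z}^r\to H$ is the (well-defined) homomorphism $\gamma(\mathbf a)(\eta_1^{b_1}\cdots\eta_r^{b_r})=\prod_{i,j=1}^rq_{ij}^{a_ib_j}$. *)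

(* Defs.v *)
From HB Require Import structures.
From mathcomp Require Import all_boot all_order all_algebra all_fingroup.
From mathcomp Require Import sesquilinear.
From mathcomp Require Import boolp classical_sets functions reals.
From mathcomp Require Export complex.

Set Implicit Arguments.
Unset Strict Implicit.
Unset Printing Implicit Defensive.

Import GRing.Theory.
Local Open Scope classical_set_scope.
Local Open Scope ring_scope.

(** * Homomorphisms from G to the units of K, as an additive group *)

Section Characters.
Variables (K : fieldType) (G : finGroupType).

(* A multiplicative map sending 1 to 1 takes its values in the units of K. *)
Definition is_hom_units (f : {ffun G -> K}) : bool :=
  (f 1%g == 1) && [forall x, forall y, f (x * y)%g == f x * f y].

Record hom_units := HomUnits {
  hom_units_fun :> {ffun G -> K};
  hom_unitsP : is_hom_units hom_units_fun }.

HB.instance Definition _ := [isSub for hom_units_fun].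
HB.instance Definition _ := [Choice of hom_units by <:].

Lemma hom_units1 (h : hom_units) : h 1%g = 1.
Proof. by have /andP[/eqP] := hom_unitsP h. Qed.

Lemma hom_unitsM (h : hom_units) x y : h (x * y)%g = h x * h y.
Proof. by have /andP[_ /forallP/(_ x)/forallP/(_ y)/eqP] := hom_unitsP h. Qed.

Fact hom_units_zero_subproof : is_hom_units [ffun=> 1].
Proof.
by apply/andP; split; [rewrite ffunE|
  apply/forallP=> x; apply/forallP=> y; rewrite !ffunE mulr1].
Qed.

Fact hom_units_add_subproof (g h : hom_units) :
  is_hom_units [ffun x => g x * h x].
Proof.
apply/andP; split; first by rewrite ffunE !hom_units1 mulr1.
by apply/forallP=> x; apply/forallP=> y; rewrite !ffunE !hom_unitsM mulrACA.
Qed.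

Fact hom_units_opp_subproof (g : hom_units) : is_hom_units [ffun x => (g x)^-1].
Proof.
apply/andP; split; first by rewrite ffunE hom_units1 invr1.
by apply/forallP=> x; apply/forallP=> y; rewrite !ffunE hom_unitsM invfM.
Qed.

Definition hom_units_zero := HomUnits hom_units_zero_subproof.
Definition hom_units_add g h := HomUnits (hom_units_add_subproof g h).
Definition hom_units_opp g := HomUnits (hom_units_opp_subproof g).

Fact hom_units_addA : associative hom_units_add.
Proof. by move=> f g h; apply/val_inj/ffunP => x; rewrite !ffunE mulrA. Qed.

Fact hom_units_addC : commutative hom_units_add.
Proof. by move=> f g; apply/val_inj/ffunP => x; rewrite !ffunE mulrC. Qed.

Fact hom_units_add0 : left_id hom_units_zero hom_units_add.
Proof. by move=> f; apply/val_inj/ffunP => x; rewrite !ffunE mul1r. Qed.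

Fact hom_units_addN : left_inverse hom_units_zero hom_units_opp hom_units_add.
Proof.
move=> f; apply/val_inj/ffunP => x; rewrite !ffunE mulVf //.
apply/eqP => fx0; have := hom_unitsM f x x^-1%g.
by rewrite mulgV hom_units1 fx0 mul0r => /eqP; rewrite oner_eq0.
Qed.

HB.instance Definition _ := GRing.isZmodule.Build hom_units
  hom_units_addA hom_units_addC hom_units_add0 hom_units_addN.

End Characters.

(** * Subspaces and sums of subspaces *)

Section Subspaces.
Variables (K : fieldType) (X : lmodType K).

Definition subspace (U : set X) : Prop :=
  U 0 /\ forall c u v, U u -> U v -> U (c *: u + v).

Definition span (S : set X) : set X := smallest subspace S.

Definition finite_dim (U : set X) : Prop :=
  exists s : seq X, U `<=` span [set` s].

Definition direct_sum (I : Type) (D : I -> set X) : Prop :=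
  [/\ forall i, subspace (D i),
      span (\bigcup_i D i) = setT &
      forall i, D i `&` span (\bigcup_(j in ~` [set i]) D j) `<=` [set 0]].

Definition graded_subspace (Z : Type) (Xgr : Z -> set X) (U : set X) : Prop :=
  subspace U /\ U = span (\bigcup_n (U `&` Xgr n)).

End Subspaces.

Section SubspaceType.
Variables (K : fieldType) (X : lmodType K) (U : submodClosed X).

Record submod_type := SubmodType {
  submod_val :> X;
  submod_valP : submod_val \in U }.

HB.instance Definition _ := [isSub for submod_val].
HB.instance Definition _ := [Choice of submod_type by <:].
HB.instance Definition _ := [SubChoice_isSubLmodule of submod_type by <:].

(* The restriction of f to U, meaningful when f maps U into U. *)
Definition restr (f : X -> X) (u : submod_type) : submod_type :=
  insubd (0 : submod_type) (f (val u)).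

End SubspaceType.

(* Tensor products, by their universal property. *)
Definition is_tensor_product (K : fieldType) (U V W : lmodType K)
    (t : {bilinear U -> V -> W}) : Prop :=
  forall (X : lmodType K) (f : {bilinear U -> V -> X}),
    exists g : {linear W -> X},
      (forall u v, g (t u v) = f u v) /\
      (forall g' : {linear W -> X}, (forall u v, g' (t u v) = f u v) -> g' =1 g).

(** * Graded algebras and graded modules *)

Section Graded.
Variables (K : fieldType) (Z : zmodType) (A : algType K) (M : lmodType K).
Implicit Types (Agr : Z -> set A) (Mgr : Z -> set M) (rho : A -> M -> M).

Definition graded_algebra Agr : Prop :=
  direct_sum Agr /\
  forall k l a b, Agr k a -> Agr l b -> Agr (k + l) (a * b).

Definition unital_action rho : Prop :=
  (forall x, rho 1 x = x) /\ (forall a b x, rho (a * b) x = rho a (rho b x)).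

Definition graded_module Agr Mgr rho : Prop :=
  direct_sum Mgr /\
  forall k n a x, Agr k a -> Mgr n x -> Mgr (k + n) (rho a x).

Definition quasifinite Mgr : Prop := forall n, finite_dim (Mgr n).

Definition graded_submodule Mgr rho (U : set M) : Prop :=
  graded_subspace Mgr U /\ forall a x, U x -> U (rho a x).

Definition graded_simple Mgr rho : Prop :=
  (exists x : M, x != 0) /\
  forall U, graded_submodule Mgr rho U -> U = [set 0] \/ U = setT.

(* Isomorphisms of modules on the same space M preserving the grading. *)
Definition graded_iso Mgr rho rho' (f : {linear M -> M}) : Prop :=
  [/\ bijective f, forall n, f @` Mgr n = Mgr n &
      forall a x, f (rho a x) = rho' a (f x)].

Definition twist rho (sigma : A -> A) : A -> M -> M := fun a => rho (sigma a).

(* G acts faithfully on A, i.e., it is a group of automorphisms of A. *)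
Definition graded_aut_group Agr (G : finGroupType)
    (aut : G -> {lrmorphism A -> A}) : Prop :=
  [/\ forall a, aut 1%g a = a,
      forall s t a, aut (s * t)%g a = aut s (aut t a),
      forall s t, aut s =1 aut t -> s = t &
      forall s k, aut s @` Agr k = Agr k].

End Graded.

(** * Coverings *)

Section Coverings.
Variables (K : fieldType) (Z : zmodType) (A : algType K) (M : lmodType K).
Variables (Mgr : Z -> set M) (rho : A -> M -> M).
Variables (G : finGroupType) (aut : G -> {lrmorphism A -> A}).
Local Notation H := (hom_units K G).

Definition alg_component (h : H) : set A :=
  [set a | forall s, aut s a = h s *: a].

Definition covering (C : H -> set M) : Prop :=
  [/\ forall h, graded_subspace Mgr (C h),
      span (\bigcup_h C h) = setT &
      forall g h a x, alg_component g a -> C h x -> C (g + h) (rho a x)].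

Definition thin_covering (C : H -> set M) : Prop :=
  covering C /\
  forall D, covering D -> (forall h, D h `<=` C h) -> forall h, D h = C h.

Definition equivalent_coverings (C D : H -> set M) : Prop :=
  exists k, forall h, C h = D (h + k).

End Coverings.

(** * Modules over the quantum torus *)

Section QuantumTorus.
Variables (K : fieldType) (r : nat) (X : lmodType K).
Implicit Types (q : 'M[K]_r) (t : 'I_r -> X -> X).

(* The inverse of f when f is bijective. *)
Definition inv_op (f : X -> X) (y : X) : X := xget 0 [set x | f x = y].

Definition iterz (f : X -> X) (k : int) : X -> X :=
  match k with
  | Posz n => iter n f
  | Negz n => iter n.+1 (inv_op f)
  end.

(* t_1^{a_1} \o ... \o t_r^{a_r} *)
Definition monomial t (a : 'rV[int]_r) : X -> X :=
  \big[(fun f g => f \o g)/id]_(i < r) iterz (t i) (a 0 i).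

(* A module over the algebra generated by invertible t_1, ..., t_r subject to
   t_i t_j = q_ij t_j t_i is given by the operators by which the t_i act. *)
Definition cyclotomic_qtorus_action q t : Prop :=
  [/\ forall i j, exists2 n : nat, (0 < n)%N & q i j ^+ n = 1,
      forall i, linear (t i) /\ bijective (t i) &
      forall i j x, t i (t j x) = q i j *: t j (t i x)].

(* The equality says that U is stable under both t_i and its inverse. *)
Definition qtorus_submodule t (U : set X) : Prop :=
  subspace U /\ forall i, t i @` U = U.

Definition qtorus_simple t (U : set X) : Prop :=
  [/\ qtorus_submodule t U, U <> [set 0] &
      forall W, qtorus_submodule t W -> W `<=` U -> W = [set 0] \/ W = U].

Definition qtorus_isomorphic t (U W : set X) : Prop :=
  exists f : X -> X,
    [/\ set_bij U W f,
        forall c u v, U u -> U v -> f (c *: u + v) = c *: f u + f v &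
        forall i u, U u -> f (t i u) = t i (f u)].

Definition isotypic_component t (W : set X) : Prop :=
  exists2 S, qtorus_simple t S &
    W = span (\bigcup_(S' in
                [set S' | qtorus_simple t S' /\ qtorus_isomorphic t S S']) S').

End QuantumTorus.

Section IsotypicDecomposition.
Variables (K : fieldType) (G : finGroupType) (r : nat) (eta : 'I_r -> G).
Variables (M : lmodType K) (t : 'I_r -> M -> M) (N : submodClosed M).
Local Notation H := (hom_units K G).
Local Notation Nt := (submod_type N).

(* The isomorphism between M and the direct sum of the N (x) V^h is given by its
   restrictions [iso_incl h] to the summands. *)
Record isotypic_decomposition := IsotypicDecomposition {
  iso_V : H -> lmodType K;
  iso_NV : H -> lmodType K;
  iso_tensor : forall h, {bilinear Nt -> iso_V h -> iso_NV h};
  iso_incl : forall h, {linear iso_NV h -> M};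
  iso_tensorP : forall h, is_tensor_product (iso_tensor h);
  iso_incl_inj : forall h, injective (iso_incl h);
  iso_direct_sum : direct_sum (fun h => range (iso_incl h));
  iso_action : forall h i u v,
    t i (iso_incl h (iso_tensor h u v)) =
    iso_incl h (iso_tensor h (restr (t i) u) (h (eta i) *: v));
  iso_isotypic : forall W, isotypic_component t W <->
    exists2 h, range (iso_incl h) <> [set 0] & W = range (iso_incl h) }.

Variable D : isotypic_decomposition.

(* u (x) v as an element of M *)
Definition iso_elt h (u : Nt) (v : iso_V D h) : M :=
  iso_incl D h (iso_tensor D h u v).

Definition tensor_subspace h (P : set (iso_V D h)) : set M :=
  span [set x | exists u, exists2 v, P v & x = iso_elt u v].

(* The grading on V^h with N (x) (V^h)_n = (N (x) V^h) `&` M_n. *)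
Definition induced_grading (Z : Type) (Mgr : Z -> set M) h
    (Vgr : Z -> set (iso_V D h)) : Prop :=
  direct_sum Vgr /\
  forall n, tensor_subspace (Vgr n) = range (iso_incl D h) `&` Mgr n.

Definition line_covering (gamma : 'rV[int]_r -> H) (n : Nt) (h : H) : set M :=
  span (\bigcup_a range (iso_elt (restr (monomial t a) n)
                         : iso_V D (h + gamma a) -> M)).

End IsotypicDecomposition.

(** * The map [gamma] *)

Definition expgz (G : finGroupType) (x : G) (k : int) : G :=
  match k with
  | Posz n => (x ^+ n)%g
  | Negz n => (x ^- n.+1)%g
  end.

Definition is_gamma (K : fieldType) (G : finGroupType) (r : nat)
    (eta : 'I_r -> G) (q : 'M[K]_r) (gamma : 'rV[int]_r -> hom_units K G) :=
  forall a b : 'rV[int]_r,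
    gamma a (\prod_(j < r) expgz (eta j) (b 0 j))%g =
    \prod_(i < r) \prod_(j < r) q i j ^ (a 0 i * b 0 j).

(* Main.v *)
Require Import Defs.
From HB Require Import structures.
From mathcomp Require Import all_boot all_order all_algebra all_fingroup.
From mathcomp Require Import sesquilinear ring.
From mathcomp Require Import boolp classical_sets functions reals complex.

Set Implicit Arguments.
Unset Strict Implicit.
Unset Printing Implicit Defensive.

Import Defs.
Import GRing.Theory Num.Theory.
Local Open Scope classical_set_scope.
Local Open Scope complex_scope.
Local Open Scope ring_scope.

(** The idea: any nonzero element of a covering generates, inside the covering,
    a family of the form [line_covering], up to a shift by an element of H.

    Let x be a homogeneous nonzero element of C_h, of degree m. For a in A the
    element sum_s g(s)^-1 s(a) lies in A_g, and it sends x to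
    sum_s g(s)^-1 T_s a T_s^-1 x, because T_s intertwines the action of a with
    that of s(a). Since M is graded-simple and M_m has finite dimension over an
    algebraically closed field, the degree-zero part of A acts on M_m by all
    the operators; so a can be chosen to act on M_m as z |-> eps(z) y, for some
    form eps and any prescribed homogeneous y ([component_rank_one]). For
    y = u (x) v with u in N and v in V^k this gives F_(k-g)(u) (x) v in
    C_(h+g), where F_j(u) = sum_s j(s) eps(T_s^-1 x) T_s u. The characters of a
    finite abelian group separate functions ([exists_fourier_neq0]), hence
    n = F_j(u) is nonzero for some j and u. Conjugation by T^b multiplies T_s by
    the scalar gamma(b)(s), so F_(j+gamma(b))(T^b u) = T^b n, and C_(h+g)
    contains T^b n (x) V^(g+j+gamma(b)) for all b
    ([covering_contains_line]).

    Conversely, the family attached to a line is a covering. For a in A_g and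
    v in V^k, the map that sends u in N to the component of a(u (x) v) in
    N (x) V^k' commutes with the torus up to a character. By the
    lemma of Schur such a map vanishes unless k' = k + g + gamma(b) for some b,
    and by density for N it is then of the form u |-> T^b u (x) v' ([twisted_hom_range],
    [twisted_hom_form]). The same description, applied to the projections of M
    onto the M_n, yields the gradings of the V^h ([V_gr_induced]).

    It remains to see that a family attached to a line which is contained in
    another one, after a shift, is equal to it ([line_sub_eq]): inside a nonzero
    N (x) V^k each member of the family is either zero or T^a n (x) V^k for one
    a, and this determines the line. Minimality of the families attached to
    lines and the classification of thin coverings both follow. *)

(** * Subspaces and spans *)
Lemma linear_fun0 (K : fieldType) (X Y : lmodType K) (f : X -> Y) :
  linear f -> f 0 = 0.
Proof.
move=> flin; have := flin (-1) 0 0.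
by rewrite scaler0 addr0 scaleN1r addNr.
Qed.

Lemma linear_funZ (K : fieldType) (X Y : lmodType K) (f : X -> Y) c x :
  linear f -> f (c *: x) = c *: f x.
Proof. by move=> flin; rewrite -[c *: x]addr0 flin linear_fun0 // addr0. Qed.

(** Bundling a function known to be linear, so that the theory of linear maps
    applies to functions obtained by choice. *)
Lemma linear_of (K : fieldType) (X Y : lmodType K) (f : X -> Y) :
  linear f -> exists g : {linear X -> Y}, g =1 f.
Proof.
move=> flin; pose F := GRing.isLinear.Build K X Y *:%R f flin.
by exists (HB.pack_for {linear X -> Y} f F).
Qed.

Section Subspaces.
Variables (K : fieldType) (X : lmodType K).
Implicit Types (U W S : set X) (s : seq X).

Lemma subspace0 U : subspace U -> U 0.
Proof. by case. Qed.

Lemma subspaceZ U c u : subspace U -> U u -> U (c *: u).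
Proof. by case=> U0 Ulin Uu; have := Ulin c u 0 Uu U0; rewrite addr0. Qed.

Lemma subspaceD U u v : subspace U -> U u -> U v -> U (u + v).
Proof. by case=> U0 Ulin Uu Uv; have := Ulin 1 u v Uu Uv; rewrite scale1r. Qed.

Lemma subspaceB U u v : subspace U -> U u -> U v -> U (u - v).
Proof.
by move=> Usub Uu Uv; rewrite -scaleN1r; apply: subspaceD => //; apply: subspaceZ.
Qed.

Lemma subspace_sum U (I : Type) (r : seq I) (F : I -> X) :
  subspace U -> (forall i, U (F i)) -> U (\sum_(i <- r) F i).
Proof.
move=> Usub UF; elim/big_rec: _ => [|i x _ Ux]; first exact: subspace0.
exact: subspaceD.
Qed.

Lemma subspaceI U W : subspace U -> subspace W -> subspace (U `&` W).
Proof.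
move=> [U0 Ulin] [W0 Wlin]; split; first by split.
by move=> c u v [Uu Wu] [Uv Wv]; split; [apply: Ulin|apply: Wlin].
Qed.

Lemma subspace_null : subspace [set 0 : X].
Proof. by split=> // c u v /= -> ->; rewrite scaler0 addr0. Qed.

Lemma span_subspace S : subspace (span S).
Proof.
split=> [U [[]]|c u v Su Sv U US] //.
by case: (US) => -[U0 Ulin] _; apply: Ulin; [apply: Su|apply: Sv].
Qed.

Lemma span0 S : span S 0.
Proof. by case: (span_subspace S). Qed.

Lemma subset_span S : S `<=` span S.
Proof. exact: sub_gen_smallest. Qed.

Lemma span_min U S : subspace U -> S `<=` U -> span S `<=` U.
Proof. exact: smallest_sub. Qed.

Lemma span_mono S S' : S `<=` S' -> span S `<=` span S'.
Proof.
move=> SS'; apply: span_min; first exact: span_subspace.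
by move=> x Sx; apply: subset_span; apply: SS'.
Qed.

Lemma span_tail (u : X) s (z : X) :
  span [set` s] z -> span [set` u :: s] z.
Proof. by apply: span_mono => y /= ys; rewrite inE ys orbT. Qed.

Lemma subspace_preim (Y : lmodType K) (f : {linear Y -> X}) U :
  subspace U -> subspace (f @^-1` U).
Proof.
case=> U0 Ulin; split=> [|c u v Uu Uv] /=; first by rewrite linear0.
by rewrite linearP; apply: Ulin.
Qed.

Lemma subspace_image (Y : lmodType K) (f : {linear Y -> X}) (W : set Y) :
  subspace W -> subspace (f @` W).
Proof.
case=> W0 Wlin; split=> [|c _ _ [u Wu <-] [v Wv <-]].
  by exists 0; rewrite ?linear0.
by exists (c *: u + v); [apply: Wlin|rewrite linearP].
Qed.

Lemma span_cons u s x : span [set` u :: s] x ->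
  exists c, exists2 y, span [set` s] y & x = c *: u + y.
Proof.
move: x; apply: span_min => [|x /=].
  split=> [|c x y].
    by exists 0, 0; [exact: span0|rewrite scale0r addr0].
  move=> [a [x' sx' ->]] [b [y' sy' ->]].
  exists (c * a + b), (c *: x' + y'); first exact: (span_subspace _).2.
  by rewrite scalerDr scalerDl scalerA addrACA.
rewrite inE => /orP[/eqP->|xs].
  by exists 1, 0; [exact: span0|rewrite scale1r addr0].
by exists 0, x; [apply: subset_span|rewrite scale0r add0r].
Qed.

Lemma span_seqP s x : span [set` s] x ->
  exists c : nat -> K, x = \sum_(i < size s) c i *: s`_i.
Proof.
elim: s x => [|u s IHs] x.
  move=> sx; exists (fun=> 0); rewrite big_ord0.
  by move: x sx; apply: span_min => //; exact: subspace_null.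
move=> /span_cons[a [y /IHs[c ->] ->]].
by exists (fun i => if i is j.+1 then c j else a); rewrite big_ord_recl.
Qed.

(** The matrix of coordinates has more rows than columns, hence a nonzero left
    kernel. *)
Lemma dependence s n (v : 'I_n -> X) : (size s < n)%N ->
  (forall i, span [set` s] (v i)) ->
  exists2 p : 'rV[K]_n, p != 0 & \sum_i p 0 i *: v i = 0.
Proof.
move=> ltsn sv; have /choice[c cE] i := span_seqP (sv i).
pose C := \matrix_(i < n, j < size s) c i j.
have kerC : kermx C != 0.
  rewrite kermx_eq0 /row_free neq_ltn; apply/orP; left.
  exact: leq_ltn_trans (rank_leq_col C) ltsn.
exists (nz_row (kermx C)); first by rewrite nz_row_eq0.
have /sub_kermxP/rowP pC := nz_row_sub (kermx C).
under eq_bigr do rewrite cE scaler_sumr.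
rewrite exchange_big big1 //= => j _.
under eq_bigr do rewrite scalerA.
rewrite -scaler_suml; have := pC j; rewrite !mxE.
by under eq_bigr do rewrite mxE; move=> ->; rewrite scale0r.
Qed.

(** A form of linear independence that can be extended one vector at a time. *)
Fixpoint free_chain s : Prop :=
  if s is u :: s' then ~ span [set` s'] u /\ free_chain s' else True.

Lemma span_nth s (c : nat -> K) :
  span [set` s] (\sum_(i < size s) c i *: s`_i).
Proof.
apply: (subspace_sum _ (span_subspace _)) => i.
apply: (subspaceZ _ (span_subspace _)).
by apply: subset_span; apply: mem_nth.
Qed.

Lemma chain_free s (c : nat -> K) : free_chain s ->
  \sum_(i < size s) c i *: s`_i = 0 -> forall i, (i < size s)%N -> c i = 0.
Proof.
elim: s c => [//|u s IHs] c [us ch]; rewrite big_ord_recl => sum_eq0.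
have sum0 : c 0%N *: u + \sum_(i < size s) c i.+1 *: s`_i = 0 by exact: sum_eq0.
have c0 : c 0%N = 0.
  apply: contrapT => /eqP c0; apply: us.
  move/eqP: sum0; rewrite addr_eq0 => /eqP/(congr1 (fun y => (c 0%N)^-1 *: y)).
  rewrite scalerA mulVf // scale1r => ->.
  apply: (subspaceZ _ (span_subspace _)).
  rewrite -scaleN1r; apply: (subspaceZ _ (span_subspace _)).
  exact: (@span_nth s (fun i => c i.+1)).
rewrite c0 scale0r add0r in sum0; case=> // i; rewrite ltnS => ltis.
exact: (IHs (fun i => c i.+1)).
Qed.

(** A longest chain of vectors of U whose span avoids x: by exchange, a vector
    outside the span of x and the chain could be added to it. Lengths are bounded
    by [dependence], since U lies in the span of a list. *)
Lemma basis_extension U x : subspace U -> finite_dim U -> U x -> x != 0 ->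
  exists s, [/\ forall u, u \in s -> U u, ~ span [set` s] x
              & U `<=` span [set` x :: s]].
Proof.
move=> Usub [b Ub] Ux x0.
pose good n := exists s, [/\ size s = n, forall u, u \in s -> U u, free_chain s
  & ~ span [set` s] x].
have good0 : good 0%N.
  exists [::]; split=> // sx; move/eqP: x0; apply.
  have : span [set` [::]] `<=` [set 0 : X] by exact: span_min subspace_null _.
  exact.
have good_bound n : good n -> (n <= size b)%N.
  case=> s [sn sU sc _]; rewrite leqNgt -sn; apply/negP => ltbn.
  have [i|p p0 pE] := @dependence b (size s) (fun i => s`_i) ltbn.
    by apply: Ub; apply: sU; apply: mem_nth.
  case/eqP: p0; apply/rowP => i; rewrite mxE.
  have := @chain_free s (fun j => if insub j is Some j' then p 0 j' else 0) sc.
  under eq_bigr do rewrite valK.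
  by move=> /(_ pE i (ltn_ord i)); rewrite valK.
have [n gn nmax] : exists2 n, good n & ~ good n.+1.
  apply: contrapT => Hn; have all_good n : good n.
    by elim: n => // n IHn; apply: contrapT => Hn1; apply: Hn; exists n.
  by have := good_bound _ (all_good (size b).+1); rewrite ltnn.
case: gn => s [sn sU sc xs]; exists s; split=> // u Uu.
apply: contrapT => us; apply: nmax; exists (u :: s); split=> //=.
- by rewrite sn.
- by move=> v; rewrite inE => /orP[/eqP->|/sU].
- split=> // su; apply: us; apply: span_mono su => y /= ys.
  by rewrite inE ys orbT.
move=> /span_cons[c [y sy xE]].
have [c0|c0] := eqVneq c 0; first by apply: xs; rewrite xE c0 scale0r add0r.
apply: us; have -> : u = c^-1 *: (x - y).
  by rewrite xE addrK scalerA mulVf // scale1r.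
apply: (subspaceZ _ (span_subspace _)).
apply: (subspaceB (span_subspace _)).
  by apply: subset_span; rewrite /= inE eqxx.
by apply: span_mono sy => z /= zs; rewrite inE zs orbT.
Qed.
End Subspaces.

(** * Eigenvectors *)
Section Eigenvectors.
Variables (K : closedFieldType) (X : lmodType K) (U : set X) (f : X -> X).
Hypothesis Usub : subspace U.
Hypothesis fU : forall u, U u -> U (f u).
Hypothesis flin : forall c u v, U u -> U v -> f (c *: u + v) = c *: f u + f v.

Lemma iterU i u : U u -> U (iter i f u).
Proof. by move=> Uu; elim: i => //= i IHi; apply: fU. Qed.

Lemma flin_sum n (c : nat -> K) (F : nat -> X) : (forall i, U (F i)) ->
  f (\sum_(i < n) c i *: F i) = \sum_(i < n) c i *: f (F i).
Proof.
move=> UF; elim: n => [|n IHn].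
  rewrite !big_ord0; have := flin (-1) (subspace0 Usub) (subspace0 Usub).
  by rewrite scaler0 addr0 scaleN1r addNr.
rewrite !big_ord_recr /= addrC flin // 1?addrC ?IHn //.
by apply: subspace_sum => // i; apply: subspaceZ.
Qed.

(** Split a root c off p, say p = q (X - c): either q already annihilates u, or
    q applied to u is an eigenvector for c. No dimension is involved, which is
    what [joint_eigenvector] uses for spaces of functions into M. *)
Lemma eigenvector_of_annihilator (p : {poly K}) u :
  U u -> u != 0 -> p != 0 -> \sum_(i < size p) p`_i *: iter i f u = 0 ->
  exists z c, [/\ U z, z != 0 & f z = c *: z].
Proof.
move=> Uu u0; have [n] := ubnP (size p); elim: n p => // n IHn p.
rewrite ltnS => lepn p0 pu0.
have [/eqP/size_poly1P[c c0 pE]|/closed_rootP[c /factor_theorem[q pE]]] :=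
  eqVneq (size p) 1%N.
  move/eqP: pu0; rewrite pE size_polyC c0 big_ord_recl big_ord0 addr0 /=.
  by rewrite coefC eqxx scaler_eq0 (negbTE c0) (negbTE u0).
have q0 : q != 0 by apply: contraNneq p0 => q0; rewrite pE q0 mul0r.
have szp : size p = (size q).+1 by rewrite pE size_Mmonic ?monicXsubC // size_XsubC addn2.
pose w := \sum_(i < size q) q`_i *: iter i f u.
have Uw : U w.
  by apply: subspace_sum => // i; apply: subspaceZ => //; apply: iterU.
have [w0|w0] := eqVneq w 0.
  by apply: (IHn q) => //; rewrite -ltnS -szp.
exists w, c; split=> //; apply/eqP; rewrite -subr_eq0 -pu0; apply/eqP.
rewrite (@flin_sum _ _ (fun i => iter i f u)) => [|i]; last exact: iterU.
rewrite szp pE mulrBr -[q * c%:P]mulrC mul_polyC.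
under [RHS]eq_bigr do rewrite coefB coefMX coefZ scalerBl -scalerA.
rewrite sumrB; congr (_ - _).
  by rewrite [RHS]big_ord_recl /= scale0r add0r.
by rewrite big_ord_recr /= nth_default // scale0r scaler0 addr0 scaler_sumr.
Qed.

Lemma eigenvector_finite_dim u : finite_dim U -> U u -> u != 0 ->
  exists z c, [/\ U z, z != 0 & f z = c *: z].
Proof.
move=> [b Ub] Uu u0.
have [i|p p0 pE] := @dependence _ _ b (size b).+1 (fun i => iter i f u) (ltnSn _).
  by apply: Ub; apply: iterU.
pose P := \poly_(i < (size b).+1) p 0 (inord i).
have PE i : P`_(nat_of_ord (i : 'I_(size b).+1)) = p 0 i.
  by rewrite coef_poly ltn_ord inord_val.
apply: (@eigenvector_of_annihilator P u) => //.
  apply: contraNneq p0 => P0; apply/eqP/rowP => i.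
  by rewrite -PE P0 coef0 mxE.
rewrite -[RHS]pE; under [RHS]eq_bigr do rewrite -PE.
rewrite (big_ord_widen _ (fun i => P`_i *: iter i f u) (size_poly _ _)).
rewrite big_mkcond; apply: eq_bigr => i _; case: ltnP => // ?.
by rewrite nth_default // scale0r.
Qed.
End Eigenvectors.

(** * The density theorem for simple modules of finite dimension *)
Section Density.
Variables (K : closedFieldType) (X : lmodType K) (U : set X).
Variable E : set (X -> X).
Hypothesis Usub : subspace U.
Hypothesis Ufin : finite_dim U.
Hypothesis Elin : forall e, E e -> linear e.
Hypothesis EU : forall e u, E e -> U u -> U (e u).
Hypothesis Ecomb : forall c e e', E e -> E e' -> E (fun x => c *: e x + e' x).
Hypothesis Ecomp : forall e e', E e -> E e' -> E (e \o e').
Hypothesis Etrans : forall u y, U u -> u != 0 -> U y -> exists2 e, E e & e u = y.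

(** Let u be the head of the list and J the annihilator of its tail. If J kills u
    the tail suffices. Otherwise J u = U, and sending e u to e w for e in J is a
    well-defined linear operator on U; if c is an eigenvalue of it then, U being
    simple, all of J kills w - c u, which therefore lies in the span of the
    tail. *)
Lemma double_annihilator (s : seq X) w : (forall u, u \in s -> U u) -> U w ->
  (forall e, E e -> (forall u, u \in s -> e u = 0) -> e w = 0) ->
  span [set` s] w.
Proof.
elim: s w => [|u s IHs] w sU Uw annw.
  apply: contrapT => w0; have [|e Ee ew] := Etrans Uw _ Uw.
    by apply/eqP => w_eq0; apply: w0; rewrite w_eq0; exact: span0.
  apply: w0; rewrite -ew (annw e Ee) //; exact: span0.
have Uu : U u by apply: sU; rewrite inE eqxx.
have sU' v : v \in s -> U v by move=> vs; apply: sU; rewrite inE vs orbT.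
pose J := [set e | E e /\ forall v, v \in s -> e v = 0].
have Jlin c e e' : J e -> J e' -> J (fun x => c *: e x + e' x).
  move=> [Ee es] [Ee' es']; split; first exact: Ecomb.
  by move=> v vs; rewrite es // es' // scaler0 addr0.
have Jl e e' : E e -> J e' -> J (e \o e').
  move=> Ee [Ee' es']; split; first exact: Ecomp.
  move=> v vs /=; rewrite es' //.
  exact: linear_fun0 (Elin Ee).
have Jw e : J e -> e u = 0 -> e w = 0.
  move=> [Ee es] eu; apply: annw => // v; rewrite inE => /orP[/eqP->|] //.
  exact: es.
have [/existsNP[e0 /not_implyP[Je0 /eqP e0u]]|/contrapT Ju0] :=
  pselect (~ forall e, J e -> e u = 0); last first.
  by apply: span_tail; apply: IHs => // e Ee es; apply: Jw => //; apply: Ju0.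
have Jtrans z : U z -> exists2 e, J e & e u = z.
  move=> Uz; have [|e Ee eE] := Etrans _ e0u Uz; first by apply: EU (Je0.1) Uu.
  by exists (e \o e0) => //; apply: Jl.
(* theta is the operator sending e u to e w; L chooses e *)
have /choice[L LP] : forall z, exists e, U z -> J e /\ e u = z.
  move=> z; have [/Jtrans[e Je ez]|nUz] := pselect (U z); first by exists e.
  by exists e0.
pose theta z := L z w.
have thetaE e z : J e -> U z -> e u = z -> e w = theta z.
  move=> Je Uz eu; have [JL Lu] := LP z Uz; apply/eqP; rewrite -subr_eq0.
  have := Jw _ (Jlin (-1) _ _ JL Je); rewrite Lu eu scaleN1r addNr => /(_ erefl).
  by rewrite scaleN1r addrC => ->.
have thetaU z : U z -> U (theta z).
  by move=> Uz; have [[EL _] _] := LP z Uz; exact: EU EL Uw.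
have theta_lin c y z : U y -> U z -> theta (c *: y + z) = c *: theta y + theta z.
  move=> Uy Uz; have [Jy Ly] := LP y Uy; have [Jz Lz] := LP z Uz.
  rewrite -(thetaE _ (c *: y + z) (Jlin c _ _ Jy Jz)) ?Ly ?Lz //.
  exact: Usub.2.
have [z [c [Uz z0 tz]]] :=
  eigenvector_finite_dim Usub thetaU theta_lin Ufin (EU Je0.1 Uu) e0u.
have Uwc : U (w - c *: u) by apply: subspaceB => //; apply: subspaceZ.
have : span [set` s] (w - c *: u).
  apply: IHs => // e Ee es; have Je : J e by [].
  have [d Ed dz] := Etrans Uz z0 (EU Ee Uu).
  have [JL Lz] := LP z Uz.
  rewrite -scaleNr addrC Elin // scaleNr addrC; apply/eqP; rewrite subr_eq0.
  have -> : e w = d (L z w).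
    apply/eqP; rewrite -subr_eq0; have := Jw _ (Jlin (-1) _ _ (Jl _ _ Ed JL) Je).
    by rewrite /= Lz dz !scaleN1r addNr addrC => ->.
  have dlin := Elin Ed; have := dlin c z 0.
  have d0 := linear_fun0 dlin.
  by rewrite d0 !addr0 dz -tz => ->.
move=> sw; rewrite -[w](subrK (c *: u)).
apply: (subspaceD (span_subspace _)); first exact: span_tail.
apply: (subspaceZ _ (span_subspace _)).
by apply: subset_span; rewrite /= inE eqxx.
Qed.

(** The weak form of the theorem of Burnside used below: operators of rank one
    with a prescribed image, and with a form eps that does not depend on it. *)
Lemma rank_one x : U x -> x != 0 -> exists2 eps : X -> K, eps x = 1 &
  forall y, U y -> exists2 e, E e & forall u, U u -> e u = eps u *: y.
Proof.
move=> Ux x0; have [s [sU xs Us]] := basis_extension Usub Ufin Ux x0.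
have [e0 [Ee0 e0s e0x]] : exists e, [/\ E e, forall u, u \in s -> e u = 0
    & e x != 0].
  apply: contrapT => He; apply: xs; apply: double_annihilator => // e Ee es.
  by apply: contrapT => /eqP ex; apply: He; exists e.
have e0span u : span [set` s] u -> e0 u = 0.
  move=> su; have : span [set` s] `<=` [set v | e0 v = 0]; last exact.
  apply: span_min => //; split=> /= [|c v v' vE v'E].
    exact: linear_fun0 (Elin Ee0).
  by rewrite Elin // vE v'E scaler0 addr0.
have /choice[eps epsP] : forall u, exists c : K, U u -> e0 u = c *: e0 x.
  move=> u.
  have [/Us/span_cons[c [y sy ->]]|] := pselect (U u); last by exists 0.
  by exists c => _; rewrite Elin // (e0span _ sy) addr0.
have epsx : eps x = 1.
  have /eqP := epsP x Ux; rewrite -[X in X == _]scale1r -subr_eq0 -scalerBl.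
  by rewrite scaler_eq0 (negbTE e0x) orbF subr_eq0 => /eqP.
exists eps => // y Uy; have [e Ee ey] := Etrans (EU Ee0 Ux) e0x Uy.
exists (e \o e0); first exact: Ecomp.
move=> u Uu /=; rewrite epsP // -ey -[_ *: e0 x]addr0 Elin //.
by rewrite (linear_fun0 (Elin Ee)) addr0.
Qed.
End Density.

(** * Projections of a direct sum *)
(** The last clause says that every vector is the sum of its components, without
    bounding the list of indices in advance. *)
Definition is_proj (K : fieldType) (X : lmodType K) (I : eqType) (D : I -> set X)
    (p : I -> {linear X -> X}) : Prop :=
  [/\ forall i x, D i (p i x),
      forall i x, D i x -> p i x = x,
      forall i j x, i != j -> D j x -> p i x = 0 &
      forall x, exists s : seq I, x = \sum_(i <- s) p i x].

Section DirectSum.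
Variables (K : fieldType) (X : lmodType K) (I : eqType) (D : I -> set X).
Hypothesis dsD : direct_sum D.

Lemma direct_sum_proj : exists p, is_proj D p.
Proof.
case: dsD => Dsub Dspan Ddisj.
pose O i := span (\bigcup_(j in ~` [set i]) D j).
have Osub i : subspace (O i) := span_subspace _.
have dec i x : exists y, D i y /\ O i (x - y).
  have : span (\bigcup_i D i) x by rewrite Dspan.
  move: x; apply: (@span_min _ _ [set x | exists y, D i y /\ O i (x - y)]).
    split=> [|c x y [x' [Dx Ox]] [y' [Dy Oy]]].
      by exists 0; split; [case: (Dsub i)|rewrite subr0; exact: span0].
    exists (c *: x' + y'); split; first exact: (Dsub i).2.
    by rewrite opprD addrACA -scalerBr; exact: (Osub i).2.
  move=> x [j _ Dx]; have [<-|ij] := eqVneq j i.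
    by exists x; rewrite subrr; split=> //; exact: span0.
  exists 0; rewrite subr0; split; first by case: (Dsub i).
  by apply: subset_span; exists j => //; apply/eqP.
have uniq_dec i x y y' : D i y -> O i (x - y) -> D i y' -> O i (x - y') -> y = y'.
  move=> Dy Oy Dy' Oy'; apply/eqP; rewrite -subr_eq0; apply/eqP.
  apply: (Ddisj i); split; first exact: subspaceB.
  have -> : y - y' = (x - y') - (x - y) by rewrite opprB [RHS]addrC addrA subrK.
  exact: subspaceB (Osub i) Oy' Oy.
have /choice[P PE] : forall i, exists p : {linear X -> X},
    forall x, D i (p x) /\ O i (x - p x).
  move=> i; have /choice[p pE] := dec i.
  have [|g gp] := @linear_of _ _ _ p.
    move=> c x y; have [Dx Ox] := pE x; have [Dy Oy] := pE y.
    have [Dz Oz] := pE (c *: x + y); apply: uniq_dec Dz Oz _ _.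
      exact: (Dsub i).2.
    by rewrite opprD addrACA -scalerBr; exact: (Osub i).2.
  by exists g => x; rewrite gp.
have PD i x : D i x -> P i x = x.
  move=> Dx; have [Dy Oy] := PE i x; apply: uniq_dec Dy Oy Dx _.
  by rewrite subrr; exact: span0.
have P0 i j x : i != j -> D j x -> P i x = 0.
  move=> ij Dx; have [Dy Oy] := PE i x; apply: uniq_dec Dy Oy _ _.
    by case: (Dsub i).
  by rewrite subr0; apply: subset_span; exists j => //=; apply/eqP; rewrite eq_sym.
exists P; split=> // [i x|x]; first by case: (PE i x).
suff [s us xs] : exists2 s, uniq s &
    forall s', uniq s' -> {subset s <= s'} -> x = \sum_(i <- s') P i x.
  by exists s; apply: xs.
have : span (\bigcup_i D i) x by rewrite Dspan.
move: x; apply: (@span_min _ _ [set x | exists2 s, uniq s &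
    forall s', uniq s' -> {subset s <= s'} -> x = \sum_(i <- s') P i x]).
  split=> [|c x y [s us xs] [t ut yt]].
    by exists [::] => // s' _ _; rewrite big1 // => i _; rewrite linear0.
  exists (undup (s ++ t)); rewrite ?undup_uniq // => s' us' ss'.
  under eq_bigr do rewrite linearP.
  rewrite big_split -scaler_sumr -xs -?yt // => i ii; apply: ss';
  by rewrite mem_undup mem_cat ii ?orbT.
move=> x [i _ Dx]; exists [:: i] => // s us si.
rewrite (bigD1_seq i) ?si ?inE //= PD // big1 ?addr0 // => j ji.
exact: P0 Dx.
Qed.
End DirectSum.

(** A linear map that sends summands into summands commutes with the
    projections; sg is a shift of degrees when the map is the action of a
    homogeneous element. *)
Lemma proj_morph (K : fieldType) (X Y : lmodType K) (I J : eqType)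
    (D : I -> set X) (E : J -> set Y) (p : I -> {linear X -> X})
    (p' : J -> {linear Y -> Y}) (sg : I -> J) (f : {linear X -> Y}) :
  direct_sum D -> is_proj D p -> is_proj E p' -> injective sg ->
  (forall i x, D i x -> E (sg i) (f x)) -> forall i x, p' (sg i) (f x) = f (p i x).
Proof.
move=> [_ Dspan _] [_ pD pD0 _] [_ pE pE0 _] sg_inj DE i x.
have : span (\bigcup_i D i) x by rewrite Dspan.
move: x; apply: (@span_min _ _ [set x | p' (sg i) (f x) = f (p i x)]).
  split=> [|c u v /= uE vE] /=; first by rewrite !linear0.
  by rewrite !linearP uE vE.
move=> x [j _ Dx] /=; have [ij|ij] := eqVneq i j.
  by rewrite -ij in Dx; rewrite pD // pE //; exact: DE.
rewrite (pD0 _ _ _ ij Dx) (pE0 _ (sg j)) ?linear0 //; last exact: DE.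
by rewrite (inj_eq sg_inj).
Qed.

(** * Characters of a finite abelian group *)
Section Characters.
Variables (K : numClosedFieldType) (G : finGroupType).
Local Notation H := (hom_units K G).

Lemma hom_units_neq0 (chi : H) s : chi s != 0.
Proof.
apply/eqP => chis0; have := hom_unitsM chi s s^-1%g.
by rewrite mulgV hom_units1 chis0 mul0r => /eqP; rewrite oner_eq0.
Qed.

Lemma hom_units_addE (f g : H) s : (f + g) s = f s * g s.
Proof. by rewrite /= ffunE. Qed.

Lemma hom_units_oppE (f : H) s : (- f) s = (f s)^-1.
Proof. by rewrite /= ffunE. Qed.

Lemma hom_units_0E s : (0 : H) s = 1.
Proof. by rewrite /= ffunE. Qed.

Lemma hom_units_eqP (f g : H) : (forall s, f s = g s) -> f = g.
Proof. by move=> fg; apply/val_inj/ffunP. Qed.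

Lemma hom_units_sum (chi : H) :
  \sum_s chi s = if chi == 0 then #|G|%:R else 0.
Proof.
case: eqP => [->|chi0].
  by under eq_bigr do rewrite hom_units_0E; rewrite sumr_const.
have [t chit] : exists t, chi t != 1.
  apply: contrapT => Ht; apply: chi0; apply: hom_units_eqP => s.
  rewrite hom_units_0E; apply: contrapT => /eqP chis.
  by apply: Ht; exists s.
have : (chi t - 1) * \sum_s chi s = 0.
  rewrite mulrBl mul1r mulr_sumr; apply/eqP; rewrite subr_eq0; apply/eqP.
  rewrite [RHS](reindex_inj (mulgI t)).
  by apply: eq_bigr => s _; rewrite hom_unitsM.
by move=> /eqP; rewrite mulf_eq0 subr_eq0 (negbTE chit) => /eqP.
Qed.

(** The translations by elements of G commute and have finite order, so each is
    annihilated by a polynomial X^n - 1; eigenvectors are taken successively in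
    the joint eigenspaces of the previous ones. *)
Lemma joint_eigenvector (X : lmodType K) (B : set (G -> X)) (c0 : G -> X) :
  abelian [set: G]%SET ->
  subspace B -> (forall t c, B c -> B (fun s => c (t * s)%g)) ->
  B c0 -> c0 <> 0 ->
  exists2 c, B c /\ c <> 0 & forall t, exists a, forall s, c (t * s)%g = a *: c s.
Proof.
move=> abG Bsub Btrans Bc0 c0_neq0.
have comm (s t : G) : (s * t = t * s)%g.
  by apply: (centsP abG); rewrite inE.
suff IH (l : seq G) : exists2 c, B c /\ c <> 0 &
    forall t, t \in l -> exists a, forall s, c (t * s)%g = a *: c s.
  have [c Bc ce] := IH (enum G); exists c => // t.
  by apply: ce; rewrite mem_enum.
elim: l => [|t l [c [Bc c_neq0] ce]]; first by exists c0.
have /choice[a aE] : forall t', exists b,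
    t' \in l -> forall s, c (t' * s)%g = b *: c s.
  move=> t'; have [/ce[b bE]|nl] := boolP (t' \in l); first by exists b.
  by exists 0.
pose U := [set c' | B c' /\ forall t', t' \in l ->
  forall s, c' (t' * s)%g = a t' *: c' s].
have Usub : subspace U.
  split; first by split=> [|t' _ s]; rewrite ?scaler0 //; case: Bsub.
  move=> b u v [Bu uE] [Bv vE]; split=> [|t' lt' s]; first exact: Bsub.2.
  rewrite -[LHS]/(b *: u (t' * s)%g + v (t' * s)%g) uE // vE //.
  by rewrite -[RHS]/(a t' *: (b *: u s + v s)) scalerDr !scalerA mulrC.
pose f (c' : G -> X) : G -> X := fun s => c' (t * s)%g.
have fU c' : U c' -> U (f c').
  move=> [Bc' c'E]; split=> [|t' lt' s]; first exact: Btrans.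
  by rewrite /f mulgA (comm t t') -mulgA c'E.
have fiter i (c' : G -> X) : iter i f c' = fun s => c' (t ^+ i * s)%g.
  elim: i => [|i IHi] /=; first by apply/funext => s; rewrite expg0 mul1g.
  by rewrite IHi; apply/funext => s; rewrite /f expgSr mulgA.
have ord_gt0 : (0 < #[t]%g)%N by exact: order_gt0.
have flin b u v : U u -> U v -> f (b *: u + v) = b *: f u + f v by [].
have [||||z [b [[Bz zE] z0 fz]]] :=
  @eigenvector_of_annihilator _ _ U f Usub fU flin ('X^#[t]%g - 1) c.
- by split=> // t' lt'; apply: aE.
- exact/eqP.
- by rewrite -size_poly_eq0 size_XnsubC.
- rewrite size_XnsubC //.
  under eq_bigr do rewrite coefB coefXn coef1 scalerBl.
  rewrite sumrB big_ord_recr big_ord_recl /= eqxx scale1r big1 => [|i _].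
    rewrite add0r big1 => [|i _]; last by rewrite scale0r.
    rewrite scale1r addr0 fiter expg_order.
    have -> : (fun s => c (1 * s)%g) = c by apply/funext => s; rewrite mul1g.
    exact: subrr.
  by rewrite ltn_eqF ?scale0r.
exists z; first by split=> //; apply/eqP.
move=> t'; rewrite inE => /orP[/eqP->|lt'].
  by exists b => s; have := congr1 (fun g => g s) fz.
by exists (a t') => s; apply: zE.
Qed.

(** The functions all of whose Fourier coefficients vanish form a subspace stable
    under translations. If it were not zero it would contain a joint eigenvector
    of the translations, that is chi times a constant vector for some character
    chi, and the coefficient of that function at - chi is not zero. *)
Lemma exists_fourier_neq0 (X : lmodType K) (c : G -> X) (s0 : G) :
  abelian [set: G]%SET -> c s0 != 0 -> exists j : H, \sum_s j s *: c s != 0.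
Proof.
move=> abG cs0; apply: contrapT => nj.
pose B := [set c' : G -> X | forall j : H, \sum_s j s *: c' s = 0].
have [||||c1 [Bc1 c1_neq0] c1E] := @joint_eigenvector X B c abG.
- split=> [j|b u v Bu Bv j].
    by rewrite big1 // => s _; rewrite scaler0.
  under eq_bigr => s _.
    rewrite -[(b *: u + v) s]/(b *: u s + v s) scalerDr scalerA mulrC -scalerA.
    over.
  by rewrite big_split /= -scaler_sumr Bu Bv scaler0 addr0.
- move=> t c' Bc' j; have /(congr1 (fun y => (j t)^-1 *: y)) := Bc' j.
  rewrite scaler0 (reindex_inj (mulgI t)) scaler_sumr => sum0; rewrite -[RHS]sum0.
  apply: eq_bigr => s _.
  by rewrite scalerA hom_unitsM mulKf // hom_units_neq0.
- by move=> j; apply: contrapT => /eqP nz; apply: nj; exists j.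
- by move=> c_eq0; move: cs0; rewrite c_eq0 eqxx.
have /choice[a aE] := c1E.
have c1a t : c1 t = a t *: c1 1%g by rewrite -aE mulg1.
have c11 : c1 1%g != 0.
  apply/eqP => c11; apply: c1_neq0; apply/funext => t.
  by rewrite c1a c11 scaler0.
have scal_inj b b' : b *: c1 1%g = b' *: c1 1%g -> b = b'.
  move=> /eqP; rewrite -subr_eq0 -scalerBl scaler_eq0 (negbTE c11) orbF subr_eq0.
  by move=> /eqP.
have chiP : is_hom_units [ffun t => a t].
  apply/andP; split; first by rewrite ffunE; apply/eqP/scal_inj; rewrite -c1a scale1r.
  apply/forallP => s; apply/forallP => t; rewrite !ffunE; apply/eqP/scal_inj.
  by rewrite -c1a aE (c1a t) scalerA.
pose chi := HomUnits chiP; have := Bc1 (- chi).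
have chiE s : chi s = a s by rewrite /= ffunE.
under eq_bigr do rewrite c1a scalerA hom_units_oppE -chiE mulVf ?hom_units_neq0 //.
rewrite -scaler_suml sumr_const => /eqP; rewrite scaler_eq0 (negbTE c11) orbF.
by rewrite pnatr_eq0 cardT -cardE => /eqP/card0_eq /(_ 1%g).
Qed.
End Characters.

(** * Tensor products *)
Lemma bilinear_of (K : fieldType) (U V W : lmodType K) (f : U -> V -> W) :
  (forall v, linear (f^~ v)) -> (forall u, linear (f u)) ->
  exists g : {bilinear U -> V -> W}, forall u v, g u v = f u v.
Proof.
move=> flinl flinr.
pose F := bilinear_isBilinear.Build K U V W *:%R *:%R f (conj flinl flinr).
by exists (HB.pack_for {bilinear U -> V -> W} f F).
Qed.

(** Makes the span of the pure tensors a module, to which the universal property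
    can be applied. *)
Lemma submodClosed_of (K : fieldType) (X : lmodType K) (W : set X) :
  subspace W -> exists S : submodClosed X, forall x, x \in S <-> W x.
Proof.
move=> Wsub; pose S := [pred x | `[< W x >]].
have SP : submod_closed S.
  by split=> [|c u v]; rewrite !inE; [exact: Wsub.1|exact: Wsub.2].
pose F := GRing.isSubmodClosed.Build K X S SP.
exists (HB.pack_for (submodClosed X) (S : {pred X}) F) => x.
exact: iff_sym (rwP (asboolP (W x))).
Qed.

Section TensorProducts.
Variables (K : fieldType) (U V W : lmodType K) (t : {bilinear U -> V -> W}).
Hypothesis tP : is_tensor_product t.

(** The tensor product maps to the span S of the pure tensors by the universal
    property; followed by the inclusion of S this is the identity on pure tensors,
    hence everywhere by uniqueness. *)
Lemma tensor_span : span [set x | exists u v, x = t u v] = setT.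
Proof.
set P := span _; have [S SP] := submodClosed_of (span_subspace _ : subspace P).
have tS u v : t u v \in S by apply/SP; apply: subset_span; exists u, v.
pose f u v : submod_type S := SubmodType (tS u v).
have [v c u u'|u c v v'|b bE] := @bilinear_of _ _ _ _ f.
- by apply: val_inj; rewrite linearP /= linearPl.
- by apply: val_inj; rewrite linearP /= linearPr.
have [g [gE _]] := tP b; have [g1 [_ g1uniq]] := tP t.
rewrite eqEsubset; split=> // w _; apply/SP.
have h_lin : linear (fun w => val (g w)) by move=> c x y; rewrite !linearP.
have [h hE] := linear_of h_lin.
have -> : w = h w.
  have idE : (idfun : {linear W -> W}) =1 g1 by apply: g1uniq.
  by rewrite (g1uniq h) -?idE // => u v; rewrite hE gE bE.
by rewrite hE; exact: valP.
Qed.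

Lemma tensor_contraction (eps : U -> K) :
  (forall c u u', eps (c *: u + u') = c * eps u + eps u') ->
  exists g : {linear W -> V}, forall u v, g (t u v) = eps u *: v.
Proof.
move=> epslin; have [v c u u'|u c v v'|b bE] :=
    @bilinear_of _ _ _ _ (fun u v => eps u *: v : V).
- by rewrite epslin scalerDl scalerA.
- by rewrite scalerDr !scalerA mulrC.
by have [g [gE _]] := tP b; exists g => u v; rewrite gE bE.
Qed.
End TensorProducts.

(** * Monomials in the generators of a quantum torus *)
Section Operators.
Variables (K : fieldType) (X : lmodType K).
Implicit Types (f g : X -> X) (c d : K).

Definition linear_iso f := linear f /\ bijective f.

Lemma inv_opK f : bijective f -> cancel f (inv_op f).
Proof.
move=> fbij x; apply: (bij_inj fbij).
exact: (@xgetPex _ 0 [set y | f y = f x] (ex_intro _ x erefl)).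
Qed.

Lemma inv_opKV f : bijective f -> cancel (inv_op f) f.
Proof.
by move=> fbij x; case: (fbij) => g fK gK; rewrite -{1}[x]gK inv_opK.
Qed.

Lemma linear_iso_id : linear_iso id.
Proof. by split=> //; exists id. Qed.

Lemma linear_iso_comp f g : linear_iso f -> linear_iso g -> linear_iso (f \o g).
Proof.
move=> [flin fbij] [glin gbij]; split; last exact: bij_comp.
by move=> c x y /=; rewrite glin flin.
Qed.

Lemma linear_iso_inv f : linear_iso f -> linear_iso (inv_op f).
Proof.
move=> [flin fbij]; split.
  by move=> c x y; apply: (bij_inj fbij); rewrite flin !inv_opKV.
by exists f; [apply: inv_opKV|apply: inv_opK].
Qed.

(** Properties stable under composition pass to integral powers. *)
Lemma iterz_ind (P : (X -> X) -> Prop) f :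
  P id -> (forall g h, P g -> P h -> P (g \o h)) -> P f -> P (inv_op f) ->
  forall k, P (iterz f k).
Proof.
move=> Pid Pcomp Pf Pf'; have Piter g n : P g -> P (iter n g).
  by move=> Pg; elim: n => // n IHn; apply: (Pcomp g _).
by case=> n; apply: Piter.
Qed.

(** Commutation up to the scalar c. *)
Definition scommute f g c := forall x, f (g x) = c *: g (f x).

Lemma scommute_iterzl f g c k : linear_iso f -> c != 0 ->
  linear g -> scommute f g c -> scommute (iterz f k) g (c ^ k).
Proof.
move=> [flin fbij] c0 glin fg.
have Siter h d n : linear h -> scommute h g d -> scommute (iter n h) g (d ^+ n).
  move=> hlin hg; elim: n => [|n IHn] x /=; first by rewrite expr0 scale1r.
  by rewrite IHn linear_funZ // hg scalerA -exprSr.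
case: k => n; first exact: Siter.
rewrite /= NegzE -exprz_inv; apply: (Siter (inv_op f)).
  by case: (linear_iso_inv (conj flin fbij)).
move=> x; apply: (bij_inj fbij); rewrite inv_opKV // linear_funZ // fg.
by rewrite inv_opKV // scalerA mulVf // scale1r.
Qed.

Lemma scommute_sym f g c : c != 0 -> scommute f g c -> scommute g f c^-1.
Proof. by move=> c0 fg x; rewrite fg scalerA mulVf // scale1r. Qed.

Lemma scommute_iterzr f g c k : linear_iso g -> c != 0 ->
  linear f -> scommute f g c -> scommute f (iterz g k) (c ^ k).
Proof.
move=> giso c0 flin /(scommute_sym c0) gf.
have := scommute_iterzl k giso (_ : c^-1 != 0) flin gf.
rewrite invr_eq0 => /(_ c0)/scommute_sym; rewrite exprz_inv -invr_expz invrK.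
by apply; rewrite invr_eq0 expfz_neq0.
Qed.

Lemma scommute_compl f g h c d : linear f -> scommute f h c -> scommute g h d ->
  scommute (f \o g) h (c * d).
Proof.
by move=> flin fh gh x /=; rewrite gh linear_funZ // fh scalerA mulrC.
Qed.

Lemma scommute_compr f g h c d : linear g -> scommute f g c -> scommute f h d ->
  scommute f (g \o h) (c * d).
Proof.
by move=> glin fg fh x /=; rewrite fg fh linear_funZ // scalerA.
Qed.

Lemma iterzD f j k x : bijective f -> iterz f (j + k) x = iterz f j (iterz f k x).
Proof.
move=> fbij.
have iterzS m y : iterz f (m + 1) y = f (iterz f m y).
  case: m => [n|[|n]] /=; first by rewrite addn1.
    by rewrite inv_opKV.
  by rewrite subn1 inv_opKV.
have iterzP m y : iterz f (m - 1) y = inv_op f (iterz f m y).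
  by rewrite -[in RHS](subrK 1 m) iterzS inv_opK.
elim/int_ind: j => [|n IHn|n IHn]; first by rewrite add0r.
- by rewrite -addn1 PoszD addrAC iterzS IHn -iterzS.
- by rewrite -addn1 PoszD opprD addrAC iterzP IHn -iterzP.
Qed.
End Operators.

Section Monomials.
Variables (K : fieldType) (r : nat) (X : lmodType K) (q : 'M[K]_r).
Variable t : 'I_r -> X -> X.
Hypothesis qt : cyclotomic_qtorus_action q t.
Local Notation T := (monomial t).

Let t_iso i : linear_iso (t i).
Proof. by case: qt => _ tlin _; exact: tlin. Qed.

Let t_comm i j : scommute (t i) (t j) (q i j).
Proof. by case: qt => _ _ tq x; exact: tq. Qed.

Lemma qtorus_scalar_neq0 i j : q i j != 0.
Proof.
case: qt => qroot _ _; have [[//|n] _ qn1] := qroot i j.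
by apply/eqP => q0; move/eqP: qn1; rewrite q0 expr0n /= eq_sym oner_eq0.
Qed.

Let q_neq0 := qtorus_scalar_neq0.

Lemma monomial_ind (P : (X -> X) -> Prop) :
  P id -> (forall f g, P f -> P g -> P (f \o g)) -> (forall i, P (t i)) ->
  (forall i, P (inv_op (t i))) -> forall a, P (T a).
Proof.
move=> Pid Pcomp Pt Pt' a; apply: big_ind => // i _; exact: iterz_ind.
Qed.

Lemma monomial_iso a : linear_iso (T a).
Proof.
apply: monomial_ind => [|f g|i|i]; [exact: linear_iso_id|
  exact: linear_iso_comp|exact: t_iso|exact/linear_iso_inv/t_iso].
Qed.

Lemma monomial_linear a : linear (T a). Proof. by case: (monomial_iso a). Qed.

Lemma iterz_iso i k : linear_iso (iterz (t i) k).
Proof.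
apply: iterz_ind => [|f g||]; [exact: linear_iso_id|
  exact: linear_iso_comp|exact: t_iso|exact/linear_iso_inv/t_iso].
Qed.

Lemma iterz_scommute i j k l : scommute (iterz (t i) k) (iterz (t j) l) (q i j ^ (k * l)).
Proof.
have [tlin _] := t_iso j; have [itlin _] := iterz_iso i k.
rewrite -exprz_exp; apply: scommute_iterzr => //; first by rewrite expfz_neq0.
by apply: scommute_iterzl.
Qed.

Lemma monomial_scommute a b :
  scommute (T a) (T b) (\prod_(i < r) \prod_(j < r) q i j ^ (a 0 i * b 0 j)).
Proof.
have lin1 i k : linear (iterz (t i) k) by case: (iterz_iso i k).
suff [] : linear (T a) /\ scommute (T a) (T b)
   (\prod_(i < r) \prod_(j < r) q i j ^ (a 0 i * b 0 j)) by [].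
apply: (big_ind2 (fun f c => linear f /\ scommute f (T b) c)).
- by split=> // x; rewrite scale1r.
- move=> f c g d [flin fc] [glin gd]; split; last exact: scommute_compl.
  by move=> e x y /=; rewrite glin flin.
move=> i _; split=> //.
suff [] : linear (T b) /\ scommute (iterz (t i) (a 0 i)) (T b)
   (\prod_(j < r) q i j ^ (a 0 i * b 0 j)) by [].
apply: (big_ind2 (fun f c => linear f /\ scommute (iterz (t i) (a 0 i)) f c)).
- by split=> // x; rewrite scale1r.
- move=> f c g d [flin fc] [glin gd]; split; last exact: scommute_compr.
  by move=> e x y /=; rewrite glin flin.
by move=> j _; split=> //; apply: iterz_scommute.
Qed.

(** Moving a power of t_i past the other factors costs a nonzero scalar. Only the
    existence of the scalar matters below. *)
Lemma monomialD a b : exists2 c : K, c != 0 & forall x, T a (T b x) = c *: T (a + b) x.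
Proof.
pose Tl (l : seq 'I_r) (a : 'rV[int]_r) :=
  \big[(fun f g => f \o g)/(id : X -> X)]_(i <- l) iterz (t i) (a 0 i).
have lin1 i k : linear (iterz (t i) k) by case: (iterz_iso i k).
rewrite /monomial; elim: (index_enum _) => [|i l [c c0 IHl]].
  by exists 1; rewrite ?oner_eq0 // => x; rewrite !big_nil scale1r.
have Tl_lin d : linear (Tl l d).
  apply: big_ind => // f g flin glin e x y /=; by rewrite glin flin.
have [d d0 comm] : exists2 d, d != 0 & scommute (Tl l a) (iterz (t i) (b 0 i)) d.
  suff [_ //] : linear (Tl l a) /\
    exists2 d, d != 0 & scommute (Tl l a) (iterz (t i) (b 0 i)) d.
  apply: (big_ind (fun f => linear f /\ exists2 d, d != 0 &
     scommute f (iterz (t i) (b 0 i)) d)).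
  - split=> //; exists 1; rewrite ?oner_eq0 // => x; by rewrite scale1r.
  - move=> f g [flin [d d0 fd]] [glin [e e0 ge]]; split.
      by move=> z x y /=; rewrite glin flin.
    by exists (d * e); [rewrite mulf_neq0|apply: scommute_compl].
  move=> j _; split=> //; exists (q j i ^ (a 0 j * b 0 i)).
    by rewrite expfz_neq0.
  exact: iterz_scommute.
exists (d * c) => [|x]; first by rewrite mulf_neq0.
rewrite !big_cons /= mxE iterzD; last by case: (t_iso i).
have IHl' y : Tl l a (Tl l b y) = c *: Tl l (a + b) y := IHl y.
rewrite -/(Tl l a) -/(Tl l b) comm IHl' (linear_funZ _ _ (lin1 i (b 0 i))).
by rewrite scalerA (linear_funZ _ _ (lin1 i (a 0 i))).
Qed.

Lemma monomial0 : T 0 = id.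
Proof. by rewrite /monomial; elim/big_rec: _ => // i f _ ->; rewrite mxE. Qed.

Lemma monomial_delta i : T (delta_mx 0 i) = t i.
Proof.
rewrite /monomial; have := mem_index_enum i; have := index_enum_uniq 'I_r.
have id1 (l : seq 'I_r) : i \notin l ->
    \big[(fun f g => f \o g)/(id : X -> X)]_(j <- l)
      iterz (t j) ((delta_mx 0 i : 'rV[int]_r) 0 j) = id.
  elim: l => [|j l IHl]; rewrite ?big_nil // big_cons mxE inE negb_or.
  by case/andP=> ij /IHl->; rewrite eq_sym (negbTE ij) andbF.
elim: (index_enum _) => // j l IHl /= /andP[jl ul]; rewrite inE big_cons mxE /=.
have [ij _|ij /= il] := eqVneq i j; first by rewrite id1 -?ij // ij.
by rewrite (IHl ul il).
Qed.
End Monomials.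

(** * Isotypic components *)
Section Isotypic.
Variables (K : fieldType) (r : nat) (X : lmodType K) (t : 'I_r -> X -> X).
Hypothesis t_lin : forall i, linear (t i).
Hypothesis t_inj : forall i, injective (t i).
Variable p : {linear X -> X}.
Hypothesis pt : forall i x, p (t i x) = t i (p x).

Lemma qtorus_submodule_preim S W :
  qtorus_submodule t S -> qtorus_submodule t W ->
  qtorus_submodule t (S `&` p @^-1` W).
Proof.
move=> [Ssub St] [Wsub Wt]; split; first exact/subspaceI/subspace_preim.
move=> i; rewrite eqEsubset; split=> [_ [y [Sy Wy] <-]|y [Sy Wy]].
  split; first by rewrite -(St i); exists y.
  by rewrite /= pt -(Wt i); exists (p y).
move: Sy; rewrite -{1}(St i) => -[z Sz zy]; exists z => //; split=> //.
move: Wy; rewrite /= -zy pt -{1}(Wt i) => -[w Ww /t_inj]; by move=> <-.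
Qed.

(** The image under p of a simple submodule is zero or isomorphic to it. *)
Lemma isotypic_stable W x : isotypic_component t W -> W x -> W (p x).
Proof.
move=> [S Ssimple ->]; set gens := \bigcup_(S' in _) S'.
suff : span gens `<=` p @^-1` span gens by apply.
apply: (span_min (subspace_preim p (span_subspace _))) => y.
move=> [S' [S'simple [f [fbij flin ft]]] S'y].
have [S'q S'nz S'min] := S'simple; have [S'sub S't] := S'q.
have null_q : qtorus_submodule t [set 0].
  split; first exact: subspace_null.
  move=> i; rewrite eqEsubset; split=> [_ [_ -> <-]|_ ->].
    exact: linear_fun0.
  by exists 0 => //; exact: linear_fun0.
have [ker0|kerS] := S'min _ (qtorus_submodule_preim S'q null_q) (@subIsetl _ _ _);
  last first.
  have : (S' `&` p @^-1` [set 0]) y by rewrite kerS.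
  by case=> _ /= ->; exact: span0.
have pinj u v : S' u -> S' v -> p u = p v -> u = v.
  move=> Su Sv puv; apply/eqP; rewrite -subr_eq0; apply/eqP.
  have : (S' `&` p @^-1` [set 0]) (u - v).
    by split; [exact: subspaceB|rewrite /= linearB puv subrr].
  by rewrite ker0.
apply: subset_span; exists (p @` S'); last by exists y.
split; last first.
  case: fbij => fS finj fsurj; exists (p \o f); split.
  - split=> [u Su|u v Su Sv /= puv|_ [z S'z <-]].
    + by exists (f u) => //; apply: fS.
    + by apply: finj => //; apply: pinj puv; apply: fS; exact: set_mem.
    + by have [u Su <-] := fsurj z S'z; exists u.
  - by move=> c u v Su Sv /=; rewrite flin // linearP.
  - by move=> i u Su /=; rewrite ft // pt.
split.
- split; first exact: subspace_image.
  move=> i; rewrite eqEsubset; split=> [_ [_ [z Sz <-] <-]|_ [z Sz <-]].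
    by exists (t i z); [rewrite -(S't i); exists z|rewrite pt].
  move: Sz; rewrite -{1}(S't i) => -[w Sw <-]; exists (p w); first by exists w.
  by rewrite pt.
- move=> pS0; apply: S'nz; rewrite eqEsubset; split=> [z Sz|_ ->]; last first.
    exact: S'sub.1.
  apply: pinj => //; first exact: S'sub.1.
  have : (p @` S') (p z) by exists z.
  by rewrite pS0 /= linear0.
move=> W' W'q W'S.
have [W'0|W'S'] := S'min _ (qtorus_submodule_preim S'q W'q) (@subIsetl _ _ _).
  left; rewrite eqEsubset; split=> [z Wz|_ ->]; last exact: W'q.1.1.
  have [w Sw wz] := W'S z Wz; rewrite -wz.
  have : (S' `&` p @^-1` W') w by split; rewrite //= wz.
  by rewrite W'0 => ->; rewrite linear0.
right; rewrite eqEsubset; split=> // _ [z Sz <-].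
have : (S' `&` p @^-1` W') z by rewrite W'S'.
by case.
Qed.
End Isotypic.

(** * The exponent map and the homomorphism gamma *)
Section Exponents.
Variables (G : finGroupType) (r : nat) (eta : 'I_r -> G).
Hypothesis abG : abelian [set: G]%SET.

Definition eta_exp (b : 'rV[int]_r) : G := (\prod_(j < r) expgz (eta j) (b 0 j))%g.

Let comm (x y : G) : (x * y = y * x)%g.
Proof. by apply: (centsP abG); rewrite inE. Qed.

Lemma expgzD (x : G) j k : expgz x (j + k) = (expgz x j * expgz x k)%g.
Proof.
have expgzS m : expgz x (m + 1) = (x * expgz x m)%g.
  case: m => [n|[|n]] /=; first by rewrite addn1 expgS.
    by rewrite expg0 expg1 mulgV.
  by rewrite subn1 /= [(x ^+ n.+2)%g]expgSr invMg mulKVg.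
have expgzP m : expgz x (m - 1) = (x^-1 * expgz x m)%g.
  by rewrite -[in RHS](subrK 1 m) expgzS mulKg.
elim/int_ind: j => [|n IHn|n IHn]; first by rewrite add0r /= expg0 mul1g.
- by rewrite -addn1 PoszD addrAC !expgzS IHn mulgA.
- by rewrite -addn1 PoszD opprD addrAC !expgzP IHn mulgA.
Qed.

Lemma eta_expD a b : eta_exp (a + b) = (eta_exp a * eta_exp b)%g.
Proof.
rewrite /eta_exp; elim: (index_enum _) => [|i l IHl].
  by rewrite !big_nil mulg1.
rewrite !big_cons IHl mxE expgzD -!mulgA; congr (_ * _)%g.
by rewrite !mulgA; congr (_ * _)%g; apply: comm.
Qed.

Lemma eta_exp0 : eta_exp 0 = 1%g.
Proof. by rewrite /eta_exp big1 // => i _; rewrite mxE /= expg0. Qed.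

(** The group is finite, so its elements are products of generators without
    inverses, and the factors can be collected since the group is abelian. *)
Lemma eta_exp_surj : <<[set eta i | i : 'I_r]%SET>>%g = [set: G]%SET ->
  forall s, exists b, eta_exp b = s.
Proof.
move=> gen s; have /gen_prodgP[n [c cA ->]] :
  (s \in <<[set eta i | i : 'I_r]%SET>>)%g by rewrite gen inE.
elim: n c cA => [|n IHn] c cA; first by exists 0; rewrite big_ord0 eta_exp0.
have [|b bE] := IHn (fun i => c (lift ord0 i)); first by move=> i; apply: cA.
have /imsetP[i _ ci] := cA ord0.
exists (delta_mx 0 i + b); rewrite eta_expD bE big_ord_recl; congr (_ * _)%g.
rewrite ci /eta_exp; have := mem_index_enum i; have := index_enum_uniq 'I_r.
have id1 (l : seq 'I_r) : i \notin l ->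
    (\prod_(j <- l) expgz (eta j) ((delta_mx 0 i : 'rV[int]_r) 0 j) = 1)%g.
  move=> il; rewrite big1_seq // => j /andP[_ jl].
  by rewrite mxE (negbTE (memPn il j jl)) andbF /= expg0.
elim: (index_enum _) => // j l IHl /= /andP[jl ul]; rewrite inE big_cons mxE /=.
have [ij _|ij /= il] := eqVneq i j; first by rewrite id1 -?ij ?mulg1 // ij.
by rewrite mul1g (IHl ul il).
Qed.
End Exponents.

Section Gamma.
Variables (K : numClosedFieldType) (G : finGroupType) (r : nat) (eta : 'I_r -> G).
Hypothesis abG : abelian [set: G]%SET.
Hypothesis gen : <<[set eta i | i : 'I_r]%SET>>%g = [set: G]%SET.
Variables (X : lmodType K) (q : 'M[K]_r) (t : 'I_r -> X -> X).
Hypothesis qt : cyclotomic_qtorus_action q t.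
Hypothesis X_neq0 : exists x : X, x != 0.
Variable gamma : 'rV[int]_r -> hom_units K G.
Hypothesis gammaP : is_gamma eta q gamma.
Local Notation T := (monomial t).
Local Notation "b %:G" := (eta_exp eta b) (at level 2, format "b %:G").

Let q_neq0 := qtorus_scalar_neq0 qt.

Lemma gamma_scommute a b : scommute (T a) (T b) (gamma a b%:G).
Proof. by rewrite gammaP; apply: monomial_scommute. Qed.

Lemma gammaD a b : gamma (a + b) = gamma a + gamma b.
Proof.
apply: hom_units_eqP => s; have [c <-] := eta_exp_surj abG gen s.
rewrite hom_units_addE !gammaP -big_split /=; apply: eq_bigr => i _.
rewrite -big_split /=; apply: eq_bigr => j _.
by rewrite mxE mulrDl expfzDr.
Qed.

Lemma gamma0 : gamma 0 = 0.
Proof. by apply: (addrI (gamma 0)); rewrite -gammaD !addr0. Qed.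

Lemma gammaB a b : gamma (a - b) = gamma a - gamma b.
Proof. by apply: (addIr (gamma b)); rewrite -gammaD !subrK. Qed.

(** Exchanging T^a and T^b twice gives the identity. *)
Lemma gamma_antisym a b : gamma a b%:G * gamma b a%:G = 1.
Proof.
have [x x0] := X_neq0.
have Tinj c : injective (T c) by case: (monomial_iso qt c) => _ /bij_inj.
have Tx0 : T a (T b x) != 0.
  have T0 c : T c 0 = 0 by apply/linear_fun0/(monomial_linear qt).
  by rewrite -[X in _ != X](T0 a) (inj_eq (Tinj a)) -[X in _ != X](T0 b) (inj_eq (Tinj b)).
have := gamma_scommute a b x; rewrite (gamma_scommute b a x) scalerA => /eqP.
rewrite -[X in X == _]scale1r -subr_eq0 -scalerBl scaler_eq0 (negbTE Tx0) orbF.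
by rewrite subr_eq0 => /eqP.
Qed.

(** The image of gamma is its own double orthogonal. Choose exponents b s with
    eta^(b s) = s, and evaluate the sum over s and t of gamma(b s)(t) kappa(t)^-1
    in two ways. If kappa is not in the image of gamma, summation over t gives 0.
    Summation over s, where gamma(b s)(t) = gamma(b t)(s)^-1, leaves the t with
    gamma(b t) = 0, for which kappa(t) = 1; the result is a positive integer. *)
Lemma gamma_range (kappa : hom_units K G) :
  (forall c, gamma c = 0 -> kappa c%:G = 1) -> exists b, kappa = gamma b.
Proof.
move=> kappa1; have /choice[b bE] := eta_exp_surj abG gen.
apply: contrapT => nkappa.
pose S := \sum_t \sum_s (gamma (b s) - kappa) t.
have S0 : S = 0.
  rewrite /S exchange_big big1 // => s _.
  rewrite hom_units_sum; case: eqP => // /subr0_eq gk.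
  by case: nkappa; exists (b s).
have SE : S = (\sum_t (gamma (b t) == 0)%:R) * #|G|%:R.
  rewrite /S mulr_suml; apply: eq_bigr => t' _.
  have antis s : gamma (b s) t' = (- gamma (b t')) s.
    rewrite hom_units_oppE -{1}(bE t') -{2}(bE s).
    apply: (mulIf (hom_units_neq0 (gamma (b t')) (b s)%:G)).
    by rewrite gamma_antisym mulVf // hom_units_neq0.
  under eq_bigr do rewrite hom_units_addE antis.
  rewrite -mulr_suml hom_units_sum oppr_eq0; case: eqP => g0.
    by rewrite hom_units_oppE -[t' in kappa t']bE kappa1 // invr1 mulr1 mul1r.
  by rewrite !mul0r.
have G0 : #|G|%:R != 0 :> K.
  by rewrite pnatr_eq0 cardT -cardE; apply/eqP => /card0_eq /(_ 1%g).
move/eqP: S0; rewrite SE mulf_eq0 (negbTE G0) orbF -natr_sum pnatr_eq0.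
rewrite sum_nat_eq0 => /forallP/(_ 1%g) /=.
suff -> : gamma (b 1%g) = 0 by rewrite eqxx.
apply: hom_units_eqP => s; rewrite hom_units_0E -(bE s).
have := gamma_antisym (b 1%g) (b s); rewrite (bE 1%g) hom_units1 mulr1.
by [].
Qed.
End Gamma.

(** * The action of the monomials on M and on N *)
(** Induction on a monomial together with the element of the group to which it
    corresponds. *)
Lemma monomial_eta_ind (K : fieldType) (X : lmodType K) (G : finGroupType) r
    (eta : 'I_r -> G) (t : 'I_r -> X -> X) (P : (X -> X) -> G -> Prop) :
  P id 1%g -> (forall f g s s', P f s -> P g s' -> P (f \o g) (s * s')%g) ->
  (forall i, P (t i) (eta i)) -> (forall i, P (inv_op (t i)) (eta i)^-1%g) ->
  forall a, P (monomial t a) (eta_exp eta a).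
Proof.
move=> Pid Pcomp Pt Pt' a; apply: (big_ind2 P) => [//|f s g s' Pf Pg|i _]; first exact: Pcomp.
have Piter g s n : P g s -> P (iter n g) (s ^+ n)%g.
  by move=> Pg; elim: n => [|n IHn]; rewrite ?expg0 // expgS; apply: Pcomp.
case: (a 0 i) => n; first exact: Piter.
by rewrite /= -expgVn; apply: (Piter (inv_op (t i))).
Qed.

Lemma qtorus_submodule_iff (K : fieldType) (X : lmodType K) r
    (t : 'I_r -> X -> X) (W : set X) :
  (forall i, bijective (t i)) ->
  subspace W -> (forall i x, W (t i x) <-> W x) -> qtorus_submodule t W.
Proof.
move=> tbij Wsub Wt; split=> // i; rewrite eqEsubset; split=> x.
  by move=> [y Wy <-]; apply/Wt.
case: (tbij i) => f _ fK Wx; exists (f x) => //.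
by apply: (proj1 (Wt i (f x))); rewrite fK.
Qed.

Section Setting.
Variables (K : numClosedFieldType) (Z : zmodType).
Variables (A : algType K) (Agr : Z -> set A).
Variables (M : lmodType K) (Mgr : Z -> set M) (rho : {bilinear A -> M -> M}).
Variables (Hhat : finGroupType) (aut : Hhat -> {lrmorphism A -> A}).
Variables (T : Hhat -> {linear M -> M}).
Variables (r : nat) (eta : 'I_r -> Hhat) (q : 'M[K]_r).
Variables (N : submodClosed M).
Variables (D : isotypic_decomposition eta (fun i => T (eta i)) N).
Variables (gamma : 'rV[int]_r -> hom_units K Hhat).
Local Notation H := (hom_units K Hhat).
Local Notation Nt := (submod_type N).
Local Notation t := (fun i => T (eta i) : M -> M).
Local Notation NN := [set x | x \in N].

Hypothesis hA : graded_algebra Agr.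
Hypothesis hrho : unital_action rho.
Hypothesis hM : graded_module Agr Mgr rho.
Hypothesis hsimple : graded_simple Mgr rho.
Hypothesis hquasi : quasifinite Mgr.
Hypothesis abG : abelian [set: Hhat]%SET.
Hypothesis haut : graded_aut_group Agr aut.
Hypothesis hT : forall s, graded_iso Mgr rho (twist rho (aut s)) (T s).
Hypothesis gen : <<[set eta i | i : 'I_r]%SET>>%g = [set: Hhat]%SET.
Hypothesis qt : cyclotomic_qtorus_action q (fun i => T (eta i)).
Hypothesis hN : qtorus_simple (fun i => T (eta i)) NN.
Hypothesis Nfin : finite_dim NN.
Hypothesis gammaP : is_gamma eta q gamma.
Local Notation "b %:G" := (eta_exp eta b) (at level 2, format "b %:G").
Local Notation mono a := (monomial t a).
Local Notation act a := (restr (monomial t a)).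

Lemma M_neq0 : exists x : M, x != 0.
Proof. by case: hsimple. Qed.

Lemma NN_subspace : subspace NN.
Proof. by case: hN => -[]. Qed.

Lemma iso_eltPl k c (u u' : Nt) (v : iso_V D k) :
  iso_elt (c *: u + u') v = c *: iso_elt u v + iso_elt u' v.
Proof. by rewrite /iso_elt linearPl linearP. Qed.

Lemma iso_eltPr k c (u : Nt) (v v' : iso_V D k) :
  iso_elt u (c *: v + v') = c *: iso_elt u v + iso_elt u v'.
Proof. by rewrite /iso_elt linearPr linearP. Qed.

Lemma iso_eltZl k c (u : Nt) (v : iso_V D k) :
  iso_elt (c *: u) v = c *: iso_elt u v.
Proof. by rewrite /iso_elt linearZl_LR linearZ_LR. Qed.

Lemma iso_eltZr k c (u : Nt) (v : iso_V D k) :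
  iso_elt u (c *: v) = c *: iso_elt u v.
Proof. by rewrite /iso_elt linearZr_LR linearZ_LR. Qed.

(** The properties of the monomials that are inherited from the generators; all
    are stated so that they pass to inverses. *)
Definition torus_op (f : M -> M) (s : Hhat) : Prop :=
  [/\ linear_iso f, forall n x, Mgr n (f x) <-> Mgr n x,
      forall x, (f x \in N) = (x \in N),
      forall a x, f (rho a x) = rho (aut s a) (f x) &
      forall k (u u' : Nt) (v : iso_V D k), val u' = f (val u) ->
        f (iso_elt u v) = k s *: iso_elt u' v].

(** Turns invariance under an operator, stated by images, into an equivalence,
    which is inherited by the inverse operator. *)
Lemma mem_image_eq (f : M -> M) (P : set M) : bijective f -> f @` P = P ->
  forall x, P (f x) <-> P x.
Proof.
move=> fbij fP x; split=> [|Px]; last by rewrite -fP; exists x.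
by rewrite -{1}fP => -[y Py /(bij_inj fbij)<-].
Qed.

Lemma torus_op_gen i : torus_op (T (eta i)) (eta i).
Proof.
have [_ /(_ i)[tlin tbij] _] := qt; have [_ Tgr Trho] := hT (eta i).
have [[_ Nt_stable] _ _] := hN.
have TN x : (T (eta i) x \in N) = (x \in N).
  by apply/idP/idP => /(mem_image_eq tbij (Nt_stable i)).
split=> //; first by move=> n; apply: mem_image_eq.
move=> k u u' v u'E; rewrite /iso_elt.
have /= -> := @iso_action K Hhat r eta M t N D k i u v; rewrite linearZr_LR linearZ_LR.
suff -> : restr (T (eta i)) u = u' by [].
by apply: val_inj; rewrite val_insubd TN (valP u) u'E.
Qed.

Lemma torus_op_inv f s : torus_op f s -> torus_op (inv_op f) s^-1%g.
Proof.
move=> [fiso fgr fN frho felt]; have [_ fbij] := fiso; have fK := inv_opKV fbij.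
split; first exact: linear_iso_inv.
- by move=> n x; rewrite -{2}[x]fK; apply: iff_sym.
- by move=> x; rewrite -[in RHS](fK x) fN.
- move=> a x; apply: (bij_inj fbij); rewrite fK frho fK.
  by case: haut => aut1 autM _ _; rewrite -autM mulgV aut1.
move=> k u u' v u'E; apply: (bij_inj fbij); rewrite fK.
have [flin _] := fiso; rewrite (linear_funZ _ _ flin) (felt k u' u) ?u'E ?fK //.
by rewrite scalerA -hom_unitsM mulVg hom_units1 scale1r.
Qed.

Lemma monomial_torus_op a : torus_op (mono a) a%:G.
Proof.
apply: (monomial_eta_ind (P := torus_op)); last first.
- by move=> i; apply/torus_op_inv/torus_op_gen.
- exact: torus_op_gen.
- move=> f g s s' [fiso fgr fN frho felt] [giso ggr gN grho gelt].
  split; first exact: linear_iso_comp.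
  + by move=> n x /=; rewrite fgr.
  + by move=> x /=; rewrite fN.
  + by move=> b x /=; rewrite grho frho; case: haut => _ -> _ _.
  move=> k u u' v /= u'E; have gu : g (val u) \in N by rewrite gN (valP u).
  rewrite (gelt k u (SubmodType gu)) // (linear_funZ _ _ fiso.1).
  by rewrite (felt k _ u') // scalerA mulrC -hom_unitsM.
- split=> //; first exact: linear_iso_id.
    by move=> b x; case: haut => ->.
  move=> k u u' v u'E; rewrite hom_units1 scale1r.
  by have -> : u' = u by apply: val_inj.
Qed.

Lemma mono_inj a : injective (mono a).
Proof. by have [[_ /bij_inj]] := monomial_torus_op a. Qed.

Lemma mono_linear a : linear (mono a).
Proof. by have [[]] := monomial_torus_op a. Qed.

Lemma mono_gr a n x : Mgr n (mono a x) <-> Mgr n x.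
Proof. by have [_ + _ _ _] := monomial_torus_op a; apply. Qed.

Lemma mono_N a x : (mono a x \in N) = (x \in N).
Proof. by have [_ _ + _ _] := monomial_torus_op a; apply. Qed.

Lemma mono_rho a b x : mono a (rho b x) = rho (aut a%:G b) (mono a x).
Proof. by have [_ _ _ + _] := monomial_torus_op a; apply. Qed.

Lemma val_restr (f : M -> M) (u : Nt) : f (val u) \in N -> val (restr f u) = f (val u).
Proof. by move=> fu; rewrite val_insubd fu. Qed.

Lemma val_act a (u : Nt) : val (act a u) = mono a (val u).
Proof. by rewrite val_restr // mono_N (valP u). Qed.

Lemma mono_elt a k (u : Nt) (v : iso_V D k) :
  mono a (iso_elt u v) = k a%:G *: iso_elt (act a u) v.
Proof.
by have [_ _ _ _ +] := monomial_torus_op a; apply; rewrite val_act.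
Qed.

Lemma act_linear a : linear (act a : Nt -> Nt).
Proof.
move=> c u v; apply: val_inj.
by rewrite val_act !linearP /= mono_linear !val_act.
Qed.

Lemma actZ a c (u : Nt) : act a (c *: u) = c *: act a u.
Proof. exact/linear_funZ/act_linear. Qed.

Lemma act_inj a : injective (act a : Nt -> Nt).
Proof.
move=> u v /(congr1 val); rewrite !val_act => /mono_inj; exact: val_inj.
Qed.

Lemma act0 (u : Nt) : act 0 u = u.
Proof. by apply: val_inj; rewrite val_act monomial0. Qed.

Lemma act_neq0 a (u : Nt) : u != 0 -> act a u != 0.
Proof.
by move=> u0; rewrite -(linear_fun0 (@act_linear a)) (inj_eq (@act_inj a)).
Qed.

Lemma actD a b : exists2 c : K, c != 0 &
  forall u : Nt, act a (act b u) = c *: act (a + b) u.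
Proof.
have [c c0 cE] := monomialD qt a b; exists c => // u; apply: val_inj.
by rewrite !val_act cE linearZ /= val_act.
Qed.

Lemma act_comm a b (u : Nt) : act a (act b u) = gamma a b%:G *: act b (act a u).
Proof.
apply: val_inj; rewrite linearZ /= !val_act.
exact: (gamma_scommute qt gammaP).
Qed.

Lemma act_surj a (u : Nt) : exists w, act a w = u.
Proof.
have [c c0 cE] := actD a (- a).
exists (c^-1 *: act (- a) u).
by rewrite actZ cE subrr act0 scalerA mulVf // scale1r.
Qed.

(** Simplicity of N, with invariance in the form of an equivalence. *)
Lemma N_minimal W : subspace W -> (forall i x, W (T (eta i) x) <-> W x) ->
  W `<=` NN -> (exists2 x, W x & x != 0) -> NN `<=` W.
Proof.
move=> Wsub Wt WN [x Wx x0]; have [_ tlin _] := qt.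
have Wq : qtorus_submodule (fun i => T (eta i)) W.
  by apply: qtorus_submodule_iff => // i; case: (tlin i).
case: hN => _ _ /(_ W Wq WN)[W0|-> //].
by move: Wx; rewrite W0 /= => /eqP; rewrite (negbTE x0).
Qed.

Lemma exists_N_neq0 : exists u : Nt, u != 0.
Proof.
apply: contrapT => Hu; case: hN => _ nz _; apply: nz.
rewrite eqEsubset; split=> x /= => [xN|->]; last exact: NN_subspace.1.
apply: contrapT => /eqP x0; apply: Hu; exists (SubmodType (xN : x \in N)).
by apply: contraNneq x0 => /(congr1 val) /= ->.
Qed.

Lemma tmono i : T (eta i) = mono (delta_mx 0 i) :> (M -> M).
Proof. by rewrite monomial_delta. Qed.

(** The lemma of Schur: if gamma(c) = 0 then T^c commutes with the torus, so its
    eigenspaces in N are submodules. *)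
Lemma act_scalar c : gamma c = 0 ->
  exists2 d : K, d != 0 & forall u : Nt, act c u = d *: u.
Proof.
move=> gc0; have [u0 u0_neq0] := exists_N_neq0.
have cN x : NN x -> NN (mono c x) by rewrite /= mono_N.
have clin e v v' : NN v -> NN v' -> mono c (e *: v + v') = e *: mono c v + mono c v'.
  by move=> _ _; exact: mono_linear.
have vu0 : val u0 != 0 by apply: contraNneq u0_neq0 => u00; apply/eqP/val_inj.
have [z [d [Nz z0 zE]]] :=
  eigenvector_finite_dim NN_subspace cN clin Nfin (valP u0) vu0.
pose W := [set x | x \in N /\ mono c x = d *: x].
have NW : NN `<=` W.
  apply: N_minimal.
  - split=> [|e u v [Nu uE] [Nv vE]].
      by split; [exact: NN_subspace.1|rewrite scaler0 (linear_fun0 (mono_linear c))].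
    split; first exact: NN_subspace.2.
    by rewrite mono_linear uE vE scalerDr !scalerA mulrC.
  - move=> i x; rewrite /W /= tmono mono_N (gamma_scommute qt gammaP).
    rewrite gc0 hom_units_0E scale1r -(linear_funZ _ _ (mono_linear _)).
    by split=> -[xN]; [move/mono_inj|move->].
  - by move=> x [].
  - by exists z.
exists d => [|u].
  apply: contraNneq u0_neq0 => d0; apply/eqP/(@act_inj c)/val_inj.
  rewrite (linear_fun0 (@act_linear c)) val_act.
  by case: (NW (val u0) (valP u0)) => _ ->; rewrite d0 scale0r linear0.
apply: val_inj; rewrite val_act linearZ /=.
by case: (NW (val u) (valP u)).
Qed.

(** The operator T^(a-b) is scalar on N. *)
Lemma act_eq_gamma a b : gamma a = gamma b ->
  exists2 d : K, d != 0 & forall u : Nt, act a u = d *: act b u.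
Proof.
move=> gab; have [c c0 cE] := actD (a - b) b.
have [|d d0 dE] := @act_scalar (a - b).
  by rewrite (gammaB abG gen qt gammaP) gab subrr.
exists (c^-1 * d); rewrite ?mulf_neq0 ?invr_eq0 // => u.
have := cE u; rewrite subrK dE => /(congr1 (fun x => c^-1 *: x)).
by rewrite !scalerA mulVf // scale1r => <-.
Qed.

Lemma mono_span_stable x i y :
  span (range (fun a => mono a x)) (T (eta i) y) <->
  span (range (fun a => mono a x)) y.
Proof.
set W := span _.
have gen_incl a : W (mono a x) by apply: subset_span; exists a.
have Tinj : injective (T (eta i)).
  by move=> u v; rewrite !tmono => /mono_inj.
have Wsub : subspace W := span_subspace _.
split=> [Wy|]; last first.
  have : W `<=` T (eta i) @^-1` W; last exact.
  apply: (span_min (subspace_preim (T (eta i)) Wsub)) => _ [a _ <-].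
  have [c _ cE] := monomialD qt (delta_mx 0 i) a.
  by rewrite /= tmono cE; apply: (subspaceZ _ Wsub).
have : W `<=` T (eta i) @` W.
  apply: (span_min (subspace_image (T (eta i)) Wsub)) => _ [a _ <-].
  have [c c0 cE] := monomialD qt (delta_mx 0 i) (a - delta_mx 0 i).
  exists (c^-1 *: mono (a - delta_mx 0 i) x).
    exact: (subspaceZ _ Wsub).
  by rewrite linearZ /= tmono cE scalerA mulVf // scale1r addrC subrK.
by move=> /(_ _ Wy)[z Wz /Tinj<-].
Qed.

Lemma N_generated (u y : Nt) : u != 0 ->
  span (range (fun a => mono a (val u))) (val y).
Proof.
move=> u0; apply: (N_minimal (span_subspace _)); last exact: (valP y).
- by move=> i x; apply: mono_span_stable.
- apply: (span_min NN_subspace) => _ [a _ <-] /=.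
  by rewrite mono_N (valP u).
exists (val u).
  by apply: subset_span; exists 0 => //; rewrite monomial0.
by apply: contraNneq u0 => u00; apply/eqP/val_inj.
Qed.

Local Notation torus_alg := (span (range (fun a => mono a : M -> M))).

Lemma torus_alg_linear e : torus_alg e -> linear e.
Proof.
move: e; apply: span_min => [|_ [a _ <-]]; last exact: mono_linear.
split=> [c x y|c e e' elin e'lin d x y]; first by rewrite /= scaler0 addr0.
rewrite -[LHS]/(c *: e (d *: x + y) + e' (d *: x + y)) elin e'lin.
rewrite -[(c *: e + e') x]/(c *: e x + e' x) -[(c *: e + e') y]/(c *: e y + e' y).
by rewrite !scalerDr !scalerA [c * d]mulrC addrACA.
Qed.

Lemma torus_alg_N e x : torus_alg e -> x \in N -> e x \in N.
Proof.
move=> Ee Nx; move: e Ee; apply: (@span_min _ _ [set e : M -> M | e x \in N]).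
  split; first exact: NN_subspace.1.
  by move=> c e e' /= Ne Ne'; exact: NN_subspace.2.
by move=> _ [a _ <-] /=; rewrite mono_N.
Qed.

Lemma torus_alg_comp e e' : torus_alg e -> torus_alg e' -> torus_alg (e \o e').
Proof.
move=> Ee Ee'; move: e Ee.
apply: (@span_min _ _ [set e : M -> M | torus_alg (e \o e')]).
  split=> [|c f g /= Ef Eg]; first exact: span0.
  exact: (span_subspace _).2.
move=> _ [a _ <-] /=; move: e' Ee'.
apply: (@span_min _ _ [set e' : M -> M | torus_alg (mono a \o e')]).
  split=> [|c f g /= Ef Eg].
    suff : torus_alg (mono a \o (0 : M -> M)) by [].
    rewrite [X in span _ X](_ : _ = 0); first exact: span0.
    by apply/funext => x; exact: (linear_fun0 (mono_linear a)).
  suff : torus_alg (mono a \o (c *: f + g)) by [].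
  rewrite [X in span _ X](_ : _ = c *: (mono a \o f) + (mono a \o g)).
    exact: (span_subspace _).2.
  by apply/funext => x; exact: mono_linear.
move=> _ [b _ <-] /=; have [c _ cE] := monomialD qt a b.
suff : torus_alg (mono a \o mono b) by [].
rewrite [X in span _ X](_ : _ = c *: mono (a + b)).
  by apply: (subspaceZ _ (span_subspace _)); apply: subset_span; exists (a + b).
by apply/funext => x; exact: cE.
Qed.

Lemma torus_alg_trans (u y : Nt) : u != 0 ->
  exists2 e, torus_alg e & e (val u) = val y.
Proof.
move=> u0; have := N_generated y u0; move: (val y).
apply: (@span_min _ _ [set y | exists2 e, torus_alg e & e (val u) = y]).
  split=> [|c _ _ [e Ee <-] [e' Ee' <-]]; first by exists 0; [exact: span0|].
  by exists (c *: e + e'); first exact: (span_subspace _).2.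
by move=> _ [a _ <-]; exists (mono a) => //; apply: subset_span; exists a.
Qed.

(** The density theorem for N. The form eps is linear because it is a coordinate
    of a linear operator. *)
Lemma N_rank_one (u0 : Nt) : u0 != 0 -> exists eps : Nt -> K,
  [/\ forall c u v, eps (c *: u + v) = c * eps u + eps v, eps u0 = 1 &
      forall y : Nt, exists2 e, torus_alg e &
        forall u : Nt, restr e u = eps u *: y].
Proof.
move=> u0_neq0; have vu0 : val u0 != 0.
  by apply: contraNneq u0_neq0 => u00; apply/eqP/val_inj.
have Etrans (u y : M) : NN u -> u != 0 -> NN y -> exists2 e, torus_alg e & e u = y.
  move=> Nu nu Ny; apply: (@torus_alg_trans (SubmodType Nu) (SubmodType Ny)).
  by apply: contraNneq nu => /(congr1 val) /= ->.
have [||eps eps1 epsP] := @rank_one K M NN torus_alg NN_subspace Nfin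
  torus_alg_linear _ _ torus_alg_comp Etrans (val u0) (valP u0) vu0.
- by move=> e x; apply: torus_alg_N.
- by move=> c e e' Ee Ee'; exact: (span_subspace _).2.
exists (fun u => eps (val u)); split=> // [c u v|y].
  have [e Ee eE] := epsP _ (valP u0).
  have := torus_alg_linear Ee c (val u) (val v).
  have <- : val (c *: u + v) = c *: val u + val v by rewrite linearP.
  have eE' (w : Nt) : e (val w) = eps (val w) *: val u0 := eE _ (valP w).
  rewrite !eE' scalerA -scalerDl => /eqP.
  by rewrite -subr_eq0 -scalerBl scaler_eq0 (negbTE vu0) orbF subr_eq0 => /eqP.
have [e Ee eE] := epsP _ (valP y); exists e => // u; apply: val_inj.
rewrite val_restr ?torus_alg_N ?(valP u) // linearZ /=.
exact: eE (valP u).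
Qed.

(** * Elements of N (x) V^k *)
Lemma iso_elt_sum k x : range (iso_incl D k) x ->
  exists s : seq (Nt * iso_V D k), x = \sum_(p <- s) iso_elt p.1 p.2.
Proof.
case=> w _ <-; have : span [set x | exists u v, x = iso_tensor D k u v] w.
  by rewrite (tensor_span (@iso_tensorP _ _ _ _ _ _ _ D k)).
move: w; apply: (@span_min _ _ [set w | exists s : seq (Nt * iso_V D k),
   iso_incl D k w = \sum_(p <- s) iso_elt p.1 p.2]).
  split=> [|c w w' [s sE] [s' s'E]].
    by exists [::]; rewrite big_nil linear0.
  exists ([seq (c *: p.1, p.2) | p <- s] ++ s'); rewrite linearP sE s'E.
  rewrite big_cat big_map scaler_sumr; congr (_ + _).
  by apply: eq_bigr => p _; rewrite iso_eltZl.
by move=> _ [u [v ->]]; exists [:: (u, v)]; rewrite big_seq1.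
Qed.

Lemma range_iso_incl_subspace k : subspace (range (iso_incl D k)).
Proof. exact: subspace_image. Qed.

Lemma range_iso_elt k (u : Nt) (v : iso_V D k) : range (iso_incl D k) (iso_elt u v).
Proof. by exists (iso_tensor D k u v). Qed.

(** The contraction of the first factor, extended to M without control outside
    of the summand. *)
Lemma iso_contraction k (eps : Nt -> K) :
  (forall c u v, eps (c *: u + v) = c * eps u + eps v) ->
  exists g : M -> iso_V D k, forall u v, g (iso_elt u v) = eps u *: v.
Proof.
move=> epslin; have [g gE] := tensor_contraction (@iso_tensorP _ _ _ _ _ _ _ D k) epslin.
have /choice[p pE] : forall x, exists w, range (iso_incl D k) x -> iso_incl D k w = x.
  move=> x; have [[w _ <-]|nx] := pselect (range (iso_incl D k) x); first by exists w.
  by exists 0.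
exists (g \o p) => u v /=; rewrite -gE; congr (g _).
by apply: (@iso_incl_inj _ _ _ _ _ _ _ D k); rewrite pE //; exact: range_iso_elt.
Qed.

Lemma iso_elt_eq0 k (u : Nt) (v : iso_V D k) : u != 0 -> iso_elt u v = 0 -> v = 0.
Proof.
move=> u0 uv0; have [eps [epslin eps1 _]] := N_rank_one u0.
have [g gE] := iso_contraction k epslin.
have := gE u v; rewrite uv0 eps1 scale1r => <-.
by have := gE 0 0; rewrite scaler0 /iso_elt linear0r linear0.
Qed.

(** * Homomorphisms from a twist of N *)
Section TwistedHom.
Variables (k chi : H) (f : Nt -> M).
Hypothesis flin : linear f.
Hypothesis frange : forall u, range (iso_incl D k) (f u).
Hypothesis ftwist : forall i u, f (restr (T (eta i)) u) = chi (eta i) *: T (eta i) (f u).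

Let f_act a u : f (act a u) = chi a%:G *: mono a (f u).
Proof.
pose P (g : M -> M) (s : Hhat) := [/\ linear_iso g, forall x, (g x \in N) = (x \in N) &
  forall u u' : Nt, val u' = g (val u) -> f u' = chi s *: g (f u)].
suff [_ _ Pa] : P (mono a) a%:G by apply: Pa; rewrite val_act.
apply: (monomial_eta_ind (P := P)).
- split; [exact: linear_iso_id|by []|move=> u1 u2 /val_inj->].
  by rewrite hom_units1 scale1r.
- move=> g h s s' [giso gN gf] [hiso hN' hf]; split.
  + exact: linear_iso_comp.
  + by move=> x /=; rewrite gN.
  move=> u1 u2 /= u2E; have hu : h (val u1) \in N by rewrite hN' (valP u1).
  rewrite (gf (SubmodType hu)) // (hf u1) // (linear_funZ _ _ giso.1).
  by rewrite scalerA -hom_unitsM.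
- move=> i; have [tiso _ tN _ _] := torus_op_gen i; split=> // u1 u2 u2E.
  rewrite -ftwist; congr f; apply: val_inj.
  by rewrite val_restr ?tN ?(valP u1).
- move=> i; have [tiso _ tN _ _] := torus_op_gen i.
  have [itiso _ itN _ _] := torus_op_inv (torus_op_gen i); split=> // u1 u2 u2E.
  have -> : u1 = restr (T (eta i)) u2.
    apply: val_inj; rewrite val_restr ?tN ?(valP u2) // u2E.
    by rewrite inv_opKV //; case: tiso.
  rewrite ftwist; case: tiso => tlin tbij.
  rewrite (linear_funZ _ _ itiso.1) inv_opK // scalerA -hom_unitsM mulVg.
  by rewrite hom_units1 scale1r.
Qed.

Let f_decomp u0 : exists s : seq (Nt * iso_V D k),
  forall a, f (act a u0) = (chi + k) a%:G *: \sum_(p <- s) iso_elt (act a p.1) p.2.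
Proof.
have [s sE] := iso_elt_sum (frange u0); exists s => a.
rewrite f_act sE hom_units_addE -scalerA; congr (_ *: _).
rewrite scaler_sumr; elim: s {sE} => [|p s IHs].
  by rewrite !big_nil (linear_fun0 (mono_linear a)).
rewrite !big_cons -[iso_elt p.1 p.2]scale1r mono_linear scale1r IHs.
by rewrite mono_elt.
Qed.

(** If gamma(c) = 0 then T^c acts on N, and on each N (x) V^k up to the value of
    k, by a scalar; comparing the two sides of f T^c = chi T^c f shows that chi + k
    is trivial at c. Now [gamma_range] applies. *)
Lemma twisted_hom_range u0 : f u0 != 0 -> exists b, chi + k = gamma b.
Proof.
move=> fu0; apply: (gamma_range abG gen qt M_neq0 gammaP) => c gc0.
have [d d0 dE] := act_scalar gc0; have [s sE] := f_decomp u0.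
have := sE 0; rewrite act0 eta_exp0 hom_units1 scale1r => fE.
have := sE c; rewrite dE (linear_funZ _ _ flin).
have -> : \sum_(p <- s) iso_elt (act c p.1) p.2 = d *: f u0.
  rewrite fE scaler_sumr; apply: eq_bigr => p _.
  by rewrite dE iso_eltZl act0.
rewrite scalerA => /eqP; rewrite -subr_eq0 -scalerBl scaler_eq0 (negbTE fu0) orbF.
rewrite -[X in X - _]mul1r -mulrBl mulf_eq0 (negbTE d0) orbF subr_eq0.
by move=> /eqP.
Qed.

(** When chi + k = gamma(b) the map f intertwines each operator e of the torus
    algebra on N with the operator T^b e T^-b on the first factor. Taking for e the
    operators u |-> eps(u) y of rank one, with eps(u0) = 1, one finds
    f(y) = T^b y (x) v' with v' independent of y. *)
Lemma twisted_hom_form b : chi + k = gamma b ->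
  exists v' : iso_V D k, forall u, f u = iso_elt (act b u) v'.
Proof.
move=> chik; have [u0 u0_neq0] := exists_N_neq0.
have [eps [epslin eps1 epsP]] := N_rank_one u0_neq0.
have [s sE] := f_decomp u0.
(* the first factors u_l of f u0 are written T^b w_l *)
have /choice[w wE] := act_surj b.
(* conjugation by the monomial b undoes the twist of f *)
have fe e : torus_alg e ->
    f (restr e u0) = \sum_(p <- s) iso_elt (act b (restr e (w p.1))) p.2.
  pose P := [set e : M -> M | (forall x, x \in N -> e x \in N) /\
    f (restr e u0) = \sum_(p <- s) iso_elt (act b (restr e (w p.1))) p.2].
  have restr_lin c (g g' : M -> M) (u : Nt) :
      (forall x, x \in N -> g x \in N) -> (forall x, x \in N -> g' x \in N) ->
      restr (c *: g + g') u = c *: restr g u + restr g' u.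
    move=> gN g'N; apply: val_inj.
    have gu := gN _ (valP u); have g'u := g'N _ (valP u).
    by rewrite linearP /= !val_restr //; exact: NN_subspace.2.
  suff : torus_alg `<=` P by move=> + Ee => /(_ e Ee)[].
  apply: span_min.
    split=> [|c g g' [gN gE] [g'N g'E]].
      have r0 (u : Nt) : restr (0 : M -> M) u = 0.
        by apply: val_inj; rewrite val_restr //; exact: NN_subspace.1.
      split=> [x _|]; first exact: NN_subspace.1.
      rewrite r0 (linear_fun0 flin) big1 // => p _.
      by rewrite r0 (linear_fun0 (@act_linear b)) /iso_elt linear0l linear0.
    split=> [x Nx|]; first by apply: NN_subspace.2; [exact: gN|exact: g'N].
    rewrite restr_lin // flin gE g'E scaler_sumr -big_split /=.
    by apply: eq_bigr => p _; rewrite restr_lin // act_linear iso_eltPl.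
  move=> _ [a _ <-]; split=> [x Nx|]; first by rewrite mono_N.
  rewrite sE scaler_sumr; apply: eq_bigr => p _.
  rewrite -iso_eltZl -{1}(wE p.1) act_comm scalerA chik.
  by rewrite (gamma_antisym qt M_neq0 gammaP) scale1r.
exists (\sum_(p <- s) eps (w p.1) *: p.2) => y.
have [e Ee eE] := epsP y.
have := fe e Ee; rewrite eE eps1 scale1r => ->.
rewrite /iso_elt linear_sumr linear_sum; apply: eq_bigr => p _ /=.
by rewrite eE actZ linearZl_LR linearZr_LR.
Qed.
End TwistedHom.

(** * The grading of V^k *)
Lemma iso_elt_preim_subspace k (u : Nt) (W : set M) : subspace W ->
  subspace [set v : iso_V D k | W (iso_elt u v)].
Proof.
move=> Wsub; split=> [|c v v' /= Wv Wv'].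
  by rewrite /= /iso_elt linear0r linear0; exact: subspace0.
by rewrite iso_eltPr; exact: Wsub.2.
Qed.

(** Quantifying over all of N makes N (x) (V^k)_n a subspace of M_n at once, and
    avoids the choice of a vector in N. *)
Definition V_gr (k : H) (n : Z) : set (iso_V D k) :=
  [set v | forall u : Nt, Mgr n (iso_elt u v)].
Arguments V_gr : clear implicits.

Lemma Mgr_sum : direct_sum Mgr. Proof. by case: hM. Qed.

Lemma Mgr_subspace n : subspace (Mgr n).
Proof. by case: Mgr_sum. Qed.

Lemma T_lin i : linear (T (eta i)).
Proof. by move=> c x y; rewrite linearP. Qed.

Lemma T_inj i : injective (T (eta i)).
Proof. by move=> x y; rewrite !tmono => /mono_inj. Qed.

Lemma T_elt i k (u : Nt) (v : iso_V D k) :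
  T (eta i) (iso_elt u v) = k (eta i) *: iso_elt (restr (T (eta i)) u) v.
Proof.
have [_ _ tN _] := torus_op_gen i; apply.
by rewrite val_restr // tN (valP u).
Qed.

Lemma pr_T (pr : Z -> {linear M -> M}) : is_proj Mgr pr ->
  forall n i x, pr n (T (eta i) x) = T (eta i) (pr n x).
Proof.
move=> prP n i x; apply: (proj_morph (sg := id) Mgr_sum prP prP) => // m y.
by have [_ + _ _ _] := torus_op_gen i => /(_ m y) [].
Qed.

(** The projection to degree n commutes with the torus and preserves the isotypic
    component N (x) V^k, so it is described by [twisted_hom_form] with b = 0. *)
Lemma pr_elt (pr : Z -> {linear M -> M}) k n (v : iso_V D k) : is_proj Mgr pr ->
  exists v' : iso_V D k, forall u, pr n (iso_elt u v) = iso_elt u v'.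
Proof.
move=> prP; have pr_range x : range (iso_incl D k) x -> range (iso_incl D k) (pr n x).
  have [R0|R0] := pselect (range (iso_incl D k) = [set 0]).
    by rewrite R0 => ->; rewrite linear0.
  apply: (isotypic_stable T_lin T_inj (pr_T prP n)).
  by apply/(iso_isotypic D); exists k.
have [||||v' v'E] := @twisted_hom_form k (- k) (fun u => pr n (iso_elt u v)) _ _ _ 0.
- by move=> c u u'; rewrite iso_eltPl linearP.
- by move=> u; apply/pr_range/range_iso_elt.
- move=> i u; rewrite -(pr_T prP) T_elt linearZ scalerA hom_units_oppE.
  by rewrite mulVf ?hom_units_neq0 // scale1r.
- by rewrite addNr (gamma0 abG gen qt gammaP).
by exists v' => u; rewrite v'E act0.
Qed.

Lemma V_gr_span k : span (\bigcup_n V_gr k n) = setT.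
Proof.
have [pr prP] := direct_sum_proj Mgr_sum; have [prM _ _ prsum] := prP.
have [u0 u0_neq0] := exists_N_neq0.
rewrite eqEsubset; split=> // v _.
have /choice[P PE] n := pr_elt n v prP.
have [s sE] := prsum (iso_elt u0 v).
have -> : v = \sum_(n <- s) P n.
  apply/eqP; rewrite -subr_eq0; apply/eqP/(iso_elt_eq0 u0_neq0).
  rewrite {1}/iso_elt linearBr linearB -!/(iso_elt _ _).
  apply/eqP; rewrite subr_eq0 {1}sE; apply/eqP.
  rewrite [in RHS]/iso_elt linear_sumr linear_sum.
  by apply: eq_bigr => n _; rewrite PE.
apply: (subspace_sum _ (span_subspace _)) => n.
by apply: subset_span; exists n => // u; rewrite -PE.
Qed.

Lemma V_gr_induced k : induced_grading Mgr (V_gr k).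
Proof.
have [pr prP] := direct_sum_proj Mgr_sum; have [prM prid _ prsum] := prP.
have [u0 u0_neq0] := exists_N_neq0; have [_ _ Mdisj] := Mgr_sum.
have V_gr_sub n : subspace (V_gr k n).
  split=> [u|c v v' Vv Vv' u].
    by rewrite /iso_elt linear0r linear0; exact: (Mgr_subspace n).1.
  by rewrite iso_eltPr; exact: (Mgr_subspace n).2.
split; first split=> //.
- exact: V_gr_span.
- move=> n v [Vv Ov]; apply: (iso_elt_eq0 u0_neq0); apply: (Mdisj n); split=> //.
  move: v Ov {Vv}; set O := span (\bigcup_(m in _) Mgr m).
  apply: (@span_min _ _ [set v | O (iso_elt u0 v)]).
    by apply: iso_elt_preim_subspace; exact: span_subspace.
  by move=> v [m mn Vv]; apply: subset_span; exists m.
move=> n; rewrite eqEsubset; split.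
  apply: span_min => [|_ [u [v Vv ->]]].
    exact: subspaceI (range_iso_incl_subspace k) (Mgr_subspace n).
  by split; [exact: range_iso_elt|exact: Vv].
move=> x [/iso_elt_sum[s sE] Mx]; rewrite -(prid n x Mx) sE linear_sum.
apply: (subspace_sum _ (span_subspace _)) => -[u v] /=.
have [v' v'E] := pr_elt n v prP; rewrite v'E; apply: subset_span.
by exists u, v' => // u'; rewrite -v'E.
Qed.

(** * Families attached to a line of N are coverings *)

Local Notation line := (line_covering D gamma).

Lemma line_subspace (n : Nt) h : subspace (line n h).
Proof. exact: span_subspace. Qed.

(** The equality k = h + gamma(a) is a hypothesis so that elements of V^k for
    provably equal indices need not be transported by hand. *)
Lemma mem_line (n : Nt) h a k (v : iso_V D k) :
  k = h + gamma a -> line n h (iso_elt (act a n) v).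
Proof.
by move=> kE; move: v; rewrite kE => v; apply: subset_span; exists a => //; exists v.
Qed.

Lemma line_min (n : Nt) h (W : set M) : subspace W ->
  (forall a (v : iso_V D (h + gamma a)), W (iso_elt (act a n) v)) ->
  line n h `<=` W.
Proof. by move=> Wsub WE; apply: span_min => // _ [a _ [v _ <-]]. Qed.

(** Membership of u (x) v in a subspace may be tested for homogeneous v. *)
Lemma elt_homogeneous_ind k (u : Nt) (W : set M) : subspace W ->
  (forall m (v : iso_V D k), V_gr k m v -> W (iso_elt u v)) ->
  forall v : iso_V D k, W (iso_elt u v).
Proof.
move=> Wsub WV v; have : span (\bigcup_n V_gr k n) v by rewrite V_gr_span.
move: v; apply: (@span_min _ _ [set v | W (iso_elt u v)]).
  exact: iso_elt_preim_subspace.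
by move=> v [m _]; apply: WV.
Qed.

Lemma M_span_elt (W : set M) : subspace W ->
  (forall k (u : Nt) (v : iso_V D k), W (iso_elt u v)) -> W = setT.
Proof.
move=> Wsub WE; rewrite eqEsubset; split=> // x _.
have [_ Dspan _] := iso_direct_sum D.
have : span (\bigcup_k range (iso_incl D k)) x by rewrite Dspan.
move: x; apply: span_min => // x [k _ /iso_elt_sum[s ->]].
by apply: subspace_sum.
Qed.

Lemma line_graded (n : Nt) h : graded_subspace Mgr (line n h).
Proof.
split; first exact: line_subspace.
rewrite eqEsubset; split; last first.
  by apply: (span_min (line_subspace _ _)) => x [m _ []].
apply: (line_min (span_subspace _)) => a.
apply: (elt_homogeneous_ind (span_subspace _)) => m v Vv.
by apply: subset_span; exists m => //; split; [exact: mem_line|exact: Vv].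
Qed.

Lemma line_span (n : Nt) : n != 0 -> span (\bigcup_h line n h) = setT.
Proof.
move=> n0; apply: (M_span_elt (span_subspace _)) => k u v.
set W := span _; have Wsub : subspace W := span_subspace _.
pose P := [set x : M | exists2 u : Nt, val u = x & W (iso_elt u v)].
suff : P (val u) by case=> u' /val_inj <-.
move: (val u) (N_generated u n0); apply: span_min.
  split=> [|c x y [u1 <- Wu1] [u2 <- Wu2]].
    exists 0; first by rewrite linear0.
    by rewrite /iso_elt linear0l linear0; exact: Wsub.1.
  by exists (c *: u1 + u2); [rewrite linearP|rewrite iso_eltPl; exact: Wsub.2].
move=> _ [a _ <-]; exists (act a n); first by rewrite val_act.
by apply: subset_span; exists (k - gamma a) => //; apply: mem_line; rewrite subrK.
Qed.

Lemma rho_linear a : exists f : {linear M -> M}, forall x, f x = rho a x.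
Proof.
have [f fE] : exists f : {linear M -> M}, f =1 rho a.
  by apply: linear_of => c x y; rewrite linearPr.
by exists f.
Qed.

Lemma T_rho i a x : T (eta i) (rho a x) = rho (aut (eta i) a) (T (eta i) x).
Proof. by have [_ _ _ + _] := torus_op_gen i; apply. Qed.

(** The component of a(u (x) v) in N (x) V^k' is a homomorphism in u from a twist
    of N, with character - (k + g). *)
Lemma line_stable (n : Nt) g h a x :
  alg_component aut g a -> line n h x -> line n (g + h) (rho a x).
Proof.
move=> ga; have [ra raE] := rho_linear a; rewrite -raE.
move: x; apply: (line_min (subspace_preim ra (line_subspace n (g + h)))).
move=> c v /=; rewrite raE.
have [p pP] := direct_sum_proj (iso_direct_sum D); have [pD _ _ psum] := pP.
have pT k i x : p k (T (eta i) x) = T (eta i) (p k x).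
  apply: (proj_morph (sg := id) (iso_direct_sum D) pP pP) => // k' _ [w _ <-].
  have : subspace (T (eta i) @^-1` range (iso_incl D k')).
    exact/subspace_preim/range_iso_incl_subspace.
  have [s ->] := iso_elt_sum (imageT (iso_incl D k') w).
  move=> Wsub; apply: (subspace_sum _ Wsub) => q0 /=; rewrite T_elt.
  apply: (subspaceZ _ (range_iso_incl_subspace k')); exact: range_iso_elt.
have [s ->] := psum (rho a (iso_elt (act c n) v)).
apply: (subspace_sum _ (line_subspace _ _)) => k'.
set k := h + gamma c in v *; pose f u := p k' (rho a (iso_elt u v)).
have flin : linear f.
  by move=> d u u'; rewrite /f iso_eltPl linearPr linearP.
have frange u : range (iso_incl D k') (f u) by exact: pD.
have ftwist i u : f (restr (T (eta i)) u) = (- (k + g)) (eta i) *: T (eta i) (f u).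
  rewrite /f -pT T_rho T_elt ga linearZl_LR linearZr_LR scalerA.
  rewrite linearZ_LR scalerA hom_units_oppE hom_units_addE [g _ * _]mulrC.
  by rewrite mulVf ?scale1r // mulf_neq0 // hom_units_neq0.
have [fn0|fn0] := eqVneq (f (act c n)) 0.
  by rewrite -/(f _) fn0; exact: (line_subspace _ _).1.
have [b bE] := twisted_hom_range flin frange ftwist fn0.
have [v' v'E] := twisted_hom_form flin frange ftwist bE.
rewrite -/(f _) v'E; have [d _ dE] := actD b c; rewrite dE iso_eltZl.
apply: (subspaceZ _ (line_subspace _ _)); apply: mem_line.
rewrite (gammaD abG gen qt gammaP) -bE /k.
have -> : h + gamma c + g = g + h + gamma c by rewrite addrC addrA.
rewrite [- (_ + gamma c)]opprD -!addrA [k' + _]addrC !addrA addrNK.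
by rewrite subrr add0r.
Qed.

Lemma line_is_covering (n : Nt) : n != 0 -> covering Mgr rho aut (line n).
Proof.
move=> n0; split; [exact: line_graded|exact: line_span|].
by move=> g h a x; apply: line_stable.
Qed.

(** * Every covering contains a family attached to a line *)
(** A nonzero homogeneous x generates M, and the component of a that maps x into
    degree n already maps it to y. *)
Lemma component_transitive m n x y : Mgr m x -> x != 0 -> Mgr n y ->
  exists2 a, Agr (n - m) a & rho a x = y.
Proof.
move=> Mx x0 My; have [Asum Amul] := hA; have [_ Agen _] := Asum.
have [rho1 rhoM] := hrho; have [_ rho_gr] := hM.
have [rx rxE] : exists f : {linear A -> M}, f =1 rho^~ x.
  by apply: linear_of => c a b; rewrite linearPl.
pose U := range rx.
have Usub : subspace U by exact: subspace_image.
have [U0|UT] : U = [set 0] \/ U = setT.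
- apply: hsimple.2; split; last first.
    by move=> a _ [b _ <-]; exists (a * b) => //; rewrite !rxE rhoM.
  split=> //; rewrite eqEsubset; split=> [_ [a _ <-]|]; last first.
    by apply: (span_min Usub) => z [k _ []].
  have : span (\bigcup_k Agr k) a by rewrite Agen.
  move: a; set S := span (\bigcup_k (U `&` Mgr k)).
  apply: (@span_min _ _ (rx @^-1` S)).
    exact/subspace_preim/span_subspace.
  move=> a [k _ Aa]; apply: subset_span; exists (k + m) => //; split; first by exists a.
  by rewrite rxE; exact: rho_gr.
- have : U x by exists 1 => //; rewrite rxE rho1.
  by rewrite U0 /= => x_eq0; rewrite x_eq0 eqxx in x0.
have [prA prAP] := direct_sum_proj Asum; have [prAD _ _ _] := prAP.
have [pr prP] := direct_sum_proj Mgr_sum; have [_ prid _ _] := prP.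
have [a _ ay] : U y by rewrite UT.
exists (prA (n - m) a); first exact: prAD.
rewrite -rxE -[RHS](prid n y My) -ay -[in RHS](subrK m n); symmetry.
apply: (proj_morph (sg := fun k => k + m) Asum prAP prP) => [|k b Ab].
  exact: addIr.
by rewrite rxE; exact: rho_gr.
Qed.

(** The degree-zero part of A acts irreducibly on M_m, so it contains an operator
    with image spanned by x; an element of A carrying x to y is applied next. *)
Lemma component_rank_one m x : Mgr m x -> x != 0 -> exists2 eps : M -> K,
  eps x = 1 & forall n y, Mgr n y ->
    exists a, forall u, Mgr m u -> rho a u = eps u *: y.
Proof.
move=> Mx x0; have [Asum Amul] := hA; have [Asub _ _] := Asum.
have [_ rhoM] := hrho; have [_ rho_gr] := hM.
pose E := [set rho a | a in Agr 0].
have [|||||eps eps1 epsP] := @rank_one K M (Mgr m) E (Mgr_subspace m) (hquasi m)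
   _ _ _ _ _ x Mx x0.
- by move=> _ [a _ <-] c u v; rewrite linearPr.
- by move=> _ u [a Aa <-] Mu; rewrite -[m]add0r; exact: rho_gr.
- move=> c _ _ [a Aa <-] [b Ab <-]; exists (c *: a + b); first exact: (Asub 0).2.
  by apply/funext => u; rewrite linearPl.
- move=> _ _ [a Aa <-] [b Ab <-]; exists (a * b).
    by rewrite -[0]addr0; exact: Amul.
  by apply/funext => u /=; rewrite rhoM.
- move=> u y Mu u0 My; have [a Aa aE] := component_transitive Mu u0 My.
  by exists (rho a) => //; exists a => //; rewrite subrr in Aa.
exists eps => // n y My; have [a _ aE] := component_transitive Mx x0 My.
have [_ [b _ <-] bE] := epsP x Mx.
by exists (a * b) => u Mu; rewrite rhoM bE // linearZr_LR aE.
Qed.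

Lemma covering_contains_line C : covering Mgr rho aut C ->
  exists n k, n != 0 /\ forall h, line n (h + k) `<=` C h.
Proof.
move=> [Cgr Cspan Cstable].
have [h [m [x [Cx Mx x0]]]] : exists h m x, [/\ C h x, Mgr m x & x != 0].
  apply: contrapT => Hx; have [z z0] := M_neq0.
  suff : span (\bigcup_h C h) `<=` [set 0].
    by rewrite Cspan => /(_ z Logic.I) /= z_eq0; rewrite z_eq0 eqxx in z0.
  apply: (span_min (@subspace_null _ _)) => y [h _ Cy].
  have [_ CE] := Cgr h; move: Cy; rewrite CE.
  move: y; apply: (span_min (@subspace_null _ _)) => y [m _ [Cy My]] /=.
  by apply: contrapT => /eqP y0; apply: Hx; exists h, m, y.
(* S s plays the role of T_s; being a monomial, it is known on each N (x) V^k *)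
have /choice[b bE] := eta_exp_surj abG gen.
pose S s := mono (b s); pose S' s := inv_op (S s).
have SK s : cancel (S' s) (S s).
  by apply: inv_opKV; have [[]] := monomial_torus_op (b s).
have S'M s y : Mgr m y -> Mgr m (S' s y).
  by move=> My; apply/(mono_gr (b s)); rewrite -/(S s) SK.
(* S 1 need not be the identity, so eps is normalised at its inverse image of x *)
have S'x0 : S' 1%g x != 0.
  apply: contraNneq x0 => S'x; rewrite -(SK 1%g x) S'x.
  by rewrite /S (linear_fun0 (mono_linear _)).
have [eps eps1 epsP] := component_rank_one (S'M 1%g x Mx) S'x0.
have [u0 u0_neq0] := exists_N_neq0.
pose c s := eps (S' s x) *: act (b s) u0.
have [j n_neq0] : exists j : H, \sum_s j s *: c s != 0.
  apply: (@exists_fourier_neq0 _ _ _ c 1%g abG).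
  by rewrite /c eps1 scale1r; exact: act_neq0.
set n := \sum_s _ in n_neq0.
exists n, (j - h); split=> // h'.
have [Csub _] := Cgr h'.
apply: (line_min Csub) => beta; apply: (elt_homogeneous_ind Csub) => n' v Vv.
set k := h' + (j - h) + gamma beta in v Vv *.
have [a aE] := epsP n' (iso_elt (act beta u0) v) (Vv _).
(* the component of a in A_g, up to the factor #|Hhat| *)
pose g := h' - h; pose ag := \sum_s (g s)^-1 *: aut s a.
have ag_g : alg_component aut g ag.
  move=> s; have [_ autM _ _] := haut.
  rewrite /ag linear_sum scaler_sumr [RHS](reindex_inj (mulgI s)).
  apply: eq_bigr => s' _; rewrite linearZ_LR scalerA autM; congr (_ *: _).
  by rewrite hom_unitsM invfM mulVKf // hom_units_neq0.
have := Cstable g h ag x ag_g Cx; rewrite subrK.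
suff -> : rho ag x = iso_elt (act beta n) v by [].
rewrite /ag linear_sumlz /n.
have -> : act beta (\sum_s j s *: c s) = \sum_s j s *: act beta (c s).
  have [f fE] := linear_of (@act_linear beta).
  rewrite -fE linear_sum; apply: eq_bigr => s _.
  by rewrite linearZ /= fE.
rewrite /iso_elt linear_sumlz linear_sum; apply: eq_bigr => s _.
rewrite -/(iso_elt _ _) iso_eltZl /c actZ act_comm !iso_eltZl linearZl_LR.
have {1}-> : x = S s (S' s x) by rewrite SK.
have -> : aut s a = aut (b s)%:G a by rewrite bE.
have monoZ d y : mono (b s) (d *: y) = d *: mono (b s) y.
  exact/linear_funZ/mono_linear.
rewrite -mono_rho aE; last exact: S'M.
rewrite monoZ mono_elt bE !scalerA; congr (_ *: _).
rewrite /k /g !(hom_units_addE, hom_units_oppE) invfM invrK.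
have := hom_units_neq0 h' s; have := hom_units_neq0 h s.
by move=> hs0 h's0; field; rewrite hs0 h's0.
Qed.

(** * Thin coverings *)
(** The line through T^a0 n gives the same family as the line through n, shifted
    by gamma(a0). *)
Lemma line_proportional (n n' : Nt) a0 k d : d != 0 ->
  gamma a0 = k -> n' = d *: act a0 n -> forall h, line n h `<=` line n' (h + k).
Proof.
move=> d0 ga0 n'E h; apply: (line_min (line_subspace _ _)) => a v.
have [e e0 eE] := actD (a - a0) a0.
have -> : act a n = (e^-1 * d^-1) *: act (a - a0) n'.
  by rewrite n'E actZ eE subrK !scalerA ?mulrA divfK // mulVf // scale1r.
rewrite iso_eltZl; apply: (subspaceZ _ (line_subspace _ _)); apply: mem_line.
by rewrite (gammaB abG gen qt gammaP) ga0 -addrA [k + _]addrC subrK.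
Qed.

(** Choose V^k0 different from 0 and compare the components in N (x) V^k0 at the
    index k0 - k: the smaller family has n' (x) V^k0 there, the larger one has
    T^a n (x) V^k0 with gamma(a) = k, if such an a exists, and 0 otherwise. Hence
    n' is proportional to some T^a n. *)
Lemma line_sub_eq (n n' : Nt) k : n' != 0 ->
  (forall h, line n' (h + k) `<=` line n h) ->
  forall h, line n h `<=` line n' (h + k).
Proof.
move=> n'0 sub.
have [k0 [v v0]] : exists k0 (v : iso_V D k0), v != 0.
  apply: contrapT => Hv; have [z z0] := M_neq0.
  suff M0 : [set 0] = [set: M].
    have : [set 0] z by rewrite M0.
    by move=> z_eq0; rewrite z_eq0 eqxx in z0.
  apply: (M_span_elt (@subspace_null _ _)) => k1 u v.
  have -> : v = 0 by apply: contrapT => /eqP v0; apply: Hv; exists k1, v.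
  by rewrite /= /iso_elt linear0r linear0.
have [p pP] := direct_sum_proj (iso_direct_sum D); have [_ pid p0 _] := pP.
have pE : p k0 (iso_elt n' v) = iso_elt n' v by rewrite pid //; exact: range_iso_elt.
have n'v : line n (k0 - k) (iso_elt n' v).
  apply: (sub (k0 - k)); rewrite subrK.
  rewrite -[n' in iso_elt n']act0; apply: (@mem_line n' k0 0).
  by rewrite (gamma0 abG gen qt gammaP) addr0.
have n'v_neq0 : iso_elt n' v != 0.
  by apply: contraNneq v0 => /(iso_elt_eq0 n'0) ->.
have [a0 ga0] : exists a0, gamma a0 = k.
  apply: contrapT => Ha.
  suff /(_ _ n'v) : line n (k0 - k) `<=` p k0 @^-1` [set 0].
    by rewrite /= pE => n'v_eq0; rewrite n'v_eq0 eqxx in n'v_neq0.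
  apply: line_min; first exact/subspace_preim/subspace_null.
  move=> a w /=; apply: (p0 _ _ _ _ (range_iso_elt _ _)).
  apply/eqP => k0E; apply: Ha; exists a.
  apply: (addrI (k0 - k)); rewrite -k0E.
  by rewrite subrK.
have [w wE] : exists w : iso_V D k0, iso_elt n' v = iso_elt (act a0 n) w.
  pose P := [set x | exists w : iso_V D k0, p k0 x = iso_elt (act a0 n) w].
  suff [w wE] : P (iso_elt n' v) by exists w; rewrite -wE pE.
  move: (iso_elt n' v) n'v; apply: line_min.
    split=> [|c x y [w1 w1E] [w2 w2E]].
      by exists 0; rewrite linear0 /iso_elt linear0r linear0.
    by exists (c *: w1 + w2); rewrite linearP w1E w2E iso_eltPr.
  move=> a w; have [kE|kE] := eqVneq k0 (k0 - k + gamma a); last first.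
    exists 0; rewrite (p0 _ _ _ kE (range_iso_elt _ _)).
    by rewrite /iso_elt linear0r linear0.
  have ga : gamma a = gamma a0.
    by rewrite ga0; apply: (addrI (k0 - k)); rewrite -kE subrK.
  have [d _ dE] := act_eq_gamma ga.
  move: w; rewrite -kE => w; exists (d *: w).
  by rewrite pid ?dE; [rewrite iso_eltZl iso_eltZr|exact: range_iso_elt].
(* contraction of n' (x) v = T^a0 n (x) w shows that v and w are proportional *)
have [eps [epslin eps1 _]] := N_rank_one n'0.
have [g gE] := iso_contraction k0 epslin.
have vE : v = eps (act a0 n) *: w.
  by rewrite -gE -wE gE eps1 scale1r.
set e := eps _ in vE.
have e0 : e != 0 by apply: contraNneq v0 => e0; rewrite vE e0 scale0r.
have n'E : n' = e^-1 *: act a0 n.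
  apply/eqP; rewrite -subr_eq0; apply/eqP; apply: contrapT => /eqP nz.
  move/eqP: v0; apply; apply: (iso_elt_eq0 nz).
  rewrite {1}/iso_elt linearBl linearB -!/(iso_elt _ _) wE iso_eltZl.
  by rewrite vE iso_eltZr scalerA mulVf // scale1r subrr.
by apply: (line_proportional _ ga0 n'E); rewrite invr_eq0.
Qed.

Lemma line_thin (n : Nt) : n != 0 -> thin_covering Mgr rho aut (line n).
Proof.
move=> n0; split; first exact: line_is_covering.
move=> C Ccov Csub; have [n' [k [n'0 sub]]] := covering_contains_line Ccov.
move=> h; rewrite eqEsubset; split; first exact: Csub.
apply: subset_trans (sub h); apply: line_sub_eq => // h'.
exact: subset_trans (sub h') (Csub h').
Qed.

Lemma thin_is_line C : thin_covering Mgr rho aut C ->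
  exists2 n, n != 0 & equivalent_coverings C (line n).
Proof.
move=> [Ccov Cmin]; have [n [k [n0 sub]]] := covering_contains_line Ccov.
exists n => //; exists k => h; symmetry.
apply: (Cmin (fun h => line n (h + k))) => //.
have [Lgr Lspan Lstable] := line_is_covering n0.
split=> //; last by move=> g h' a x ga Lx; rewrite -addrA; exact: Lstable.
rewrite -Lspan; congr (span _); rewrite eqEsubset; split=> x [h' _ Lx].
  by exists (h' + k).
by exists (h' - k) => //; rewrite subrK.
Qed.
End Setting.

Theorem theorem4p3 (R : realType) (Z : zmodType)
    (A : algType R[i]) (Agr : Z -> set A)
    (M : lmodType R[i]) (Mgr : Z -> set M) (rho : {bilinear A -> M -> M})
    (Hhat : finGroupType) (aut : Hhat -> {lrmorphism A -> A})
    (T : Hhat -> {linear M -> M})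
    (r : nat) (eta : 'I_r -> Hhat) (q : 'M[R[i]]_r)
    (N : submodClosed M)
    (D : isotypic_decomposition eta (fun i => T (eta i)) N)
    (gamma : 'rV[int]_r -> hom_units R[i] Hhat) :
  graded_algebra Agr ->
  unital_action rho ->
  graded_module Agr Mgr rho ->
  graded_simple Mgr rho ->
  quasifinite Mgr ->
  abelian [set: Hhat]%SET ->
  graded_aut_group Agr aut ->
  (forall s, graded_iso Mgr rho (twist rho (aut s)) (T s)) ->
  <<[set eta i | i : 'I_r]%SET>>%g = [set: Hhat]%SET ->
  cyclotomic_qtorus_action q (fun i => T (eta i)) ->
  qtorus_simple (fun i => T (eta i)) [set x | x \in N] ->
  finite_dim [set x | x \in N] ->
  is_gamma eta q gamma ->
  [/\ forall h, exists Vgr : Z -> set (iso_V D h), induced_grading Mgr Vgr,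
      forall n, n != 0 ->
        thin_covering Mgr rho aut (line_covering D gamma n) &
      forall C, thin_covering Mgr rho aut C ->
        exists2 n, n != 0 & equivalent_coverings C (line_covering D gamma n)].
Proof.
move=> hA hrho hM hsimple hquasi abG haut hT gen qt hN Nfin gammaP.
split=> [h|n n0|C Cthin].
- eexists.
  exact: (V_gr_induced D hM hsimple abG haut hT gen qt hN Nfin gammaP).
- exact: (line_thin D hA hrho hM hsimple hquasi abG haut hT gen qt hN Nfin gammaP).
- exact: (thin_is_line D hA hrho hM hsimple hquasi abG haut hT gen qt hN Nfin gammaP).
Qed.
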